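(* Let $1\le k\le n$ be integers, let $\mathcal{J}\subset\binom{[n]}{k}$ be a maximal (by inclusion) arrangement of largest minors in $Gr^+(k,n)$, let $W\in\binom{[n]}{k}$ with $W\notin\mathcal{J}$, and let $t=cube_d(\mathcal{J},W)$. If $t\in\{2,3\}$ (with $n,k$ arbitrary), or if $k=2$ (with $n,t$ arbitrary), then $W$ is a $(\ge t+1,\mathcal{J})$-largest minor.
   Context: Notation: $[n]=\{1,\dots,n\}$ and $\binom{[n]}{k}$ is the set of $k$-element subsets of $[n]$. For a real $k\times n$ matrix $A$ of rank $k$ and $I\in\binom{[n]}{k}$, $\Delta_I(A)$ is the determinant of the $k\times k$ submatrix with column set $I$ (in increasing order). The positive Grassmannian $Gr^+(k,n)$ is the set of points of the real Grassmannian $Gr(k,n)$ (matrices modulo row operations) represented by matrices $A$ with $\Delta_I(A)>0$ for all $I$; equalities and inequalities between the $\Delta_I$ are taken for such representatives (they are defined up to a common positive factor). Arrangements: An arrangement of minors with $\mathcal{U}_0=\emptyset$ is an ordered set partition $\mathcal{U}=(\mathcal{U}_0,\mathcal{U}_1,\dots,\mathcal{U}_l)$ of $\binom{[n]}{k}$ with $\mathcal{U}_0=\emptyset$ and $\mathcal{U}_1,\dots,\mathcal{U}_l$ nonempty, for which there is a point of $Gr^+(k,n)$ with $\Delta_I=\Delta_J$ whenever $I,J$ lie in the same $\mathcal{U}_i$, and $\Delta_I<\Delta_J$ whenever $I\in\mathcal{U}_i$, $J\in\mathcal{U}_j$ with $i<j$. A set $\mathcal{J}$ is an arrangement of largest minors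 if there is such an arrangement $\mathcal{U}$ with $\mathcal{U}_l=\mathcal{J}$. $W\in\binom{[n]}{k}$ is a $(\ge t,\mathcal{J})$-largest minor if for every such arrangement $\mathcal{U}$ with $\mathcal{U}_l=\mathcal{J}$ one has $W\notin\mathcal{U}_l,\mathcal{U}_{l-1},\dots,\mathcal{U}_{l-t+2}$ (sets with negative index being regarded as empty). Sortedness: For $I,J\in\binom{[n]}{k}$ let $a_1\le\dots\le a_{2k}$ be the non-decreasing rearrangement of the multiset union of $I$ and $J$; put $Sort_1(I,J)=\{a_1,a_3,\dots,a_{2k-1}\}$, $Sort_2(I,J)=\{a_2,a_4,\dots,a_{2k}\}$. The pair $I,J$ is sorted if $\{I,J\}=\{Sort_1(I,J),Sort_2(I,J)\}$; a collection is sorted if every two of its elements are sorted. It is known that all inclusion-maximal sorted collections have exactly $n$ elements, and that arrangements of largest minors are exactly the nonempty sorted collections. Dual graph and cubical distance: $\Gamma_{(k,n)}$ is the graph whose vertices are the maximal sorted collections in $\binom{[n]}{k}$, two being adjacent iff they have exactly $n-1$ elements in common (this is the dual graph of Sturmfels' triangulation of the hypersimplex). A cube in $\Gamma_{(k,n)}$ is a subgraph isomorphic to the graph (1-skeleton) of an $m$-dimensional cube for some $m\ge1$ (an edge for $m=1$, a square for $m=2$, etc.). For maximal sorted collections $\mathcal{J}_1,\mathcal{J}_2$, $cube_d(\mathcal{J}_1,\mathcal{J}_2)=D$ if $D$ is the minimal number such that one can get from $\mathcal{J}_1$ to $\mathcal{J}_2$ by moving along $D$ cubes, i.e. there is a sequence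 $\mathcal{J}_1=\mathcal{I}_0,\mathcal{I}_1,\dots,\mathcal{I}_D=\mathcal{J}_2$ of vertices with each consecutive pair lying on a common cube. For $W\in\binom{[n]}{k}$, $cube_d(\mathcal{J}_1,W)$ is the minimum of $cube_d(\mathcal{J}_1,\mathcal{J}_2)$ over all vertices $\mathcal{J}_2$ of $\Gamma_{(k,n)}$ with $W\in\mathcal{J}_2$. *)

(* Defs.v *)
From HB Require Import structures.
From mathcomp Require Import all_boot all_order all_algebra.
From mathcomp Require Import reals.

Set Implicit Arguments.
Unset Strict Implicit.
Unset Printing Implicit Defensive.

Import GRing.Theory Num.Theory.

(* Elements and indices are shifted by one throughout: [n] is 'I_n. *)
Definition ksub (n k : nat) : Type := {I : {set 'I_n} | #|I| == k}.
HB.instance Definition _ (n k : nat) := SubFinite.on (ksub n k).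

Section Minors.
Local Open Scope ring_scope.

(* Since [enum 'I_n] is increasing, so is [enum_val] on a subset of 'I_n:
   the columns are taken in increasing order. *)
Definition column n k (I : ksub n k) (j : 'I_k) : 'I_n :=
  enum_val (cast_ord (esym (eqP (valP I))) j).

Lemma column_increasing n k (I : ksub n k) (i j : 'I_k) :
  (i < j)%N -> (column I i < column I j)%N.
Proof.
have ltn_tr : transitive (fun x y : 'I_n => (x < y)%N).
  by move=> y x z; apply: ltn_trans.
have srt : sorted (fun x y : 'I_n => (x < y)%N) (enum (val I)).
  rewrite /(enum _) -enumT; apply: sorted_filter => //=.
  have := iota_ltn_sorted 0 n.
  by rewrite -val_enum_ord sorted_map.
have szI : size (enum (val I)) = k by rewrite -cardE; apply/eqP/(valP I).
move=> lt_ij; have x0 := column I i.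
rewrite /column !(enum_val_nth x0) /=.
by apply: (sorted_ltn_nth ltn_tr x0 srt); rewrite ?inE ?szI ?ltn_ord.
Qed.

Definition Delta (R : realType) n k (A : 'M[R]_(k, n)) (I : ksub n k) : R :=
  \det (colsub (column I) A).

(* A matrix representing a point of Gr^+(k,n) by positive maximal minors. *)
Definition Gr_pos_repr (R : realType) n k (A : 'M[R]_(k, n)) : Prop :=
  \rank A = k /\ forall I : ksub n k, 0 < Delta A I.

(* (U_0, ..., U_l) with U_0 empty and U_1, ..., U_l nonempty. *)
Record ordered_set_partition n k l (U : 'I_l.+1 -> {set ksub n k}) : Prop := {
  osp_disjoint : forall i j, i != j -> [disjoint U i & U j];
  osp_cover : \bigcup_i U i = [set: ksub n k];
  osp_zero : U ord0 = set0;
  osp_nonempty : forall i, i != ord0 -> U i != set0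
}.

Definition arrangement_of_minors (R : realType) n k l
    (U : 'I_l.+1 -> {set ksub n k}) : Prop :=
  ordered_set_partition U /\
  exists A : 'M[R]_(k, n),
    [/\ Gr_pos_repr A,
        forall (i : 'I_l.+1) (I J : ksub n k), I \in U i -> J \in U i ->
          Delta A I = Delta A J
      & forall (i j : 'I_l.+1) (I J : ksub n k),
          (i < j)%N -> I \in U i -> J \in U j ->
          Delta A I < Delta A J].

Definition arrangement_of_largest_minors (R : realType) n k
    (J : {set ksub n k}) : Prop :=
  exists l (U : 'I_l.+1 -> {set ksub n k}),
    arrangement_of_minors R U /\ U ord_max = J.

Definition maximal_arrangement_of_largest_minors (R : realType) n k
    (J : {set ksub n k}) : Prop :=
  arrangement_of_largest_minors R J /\
  forall J' : {set ksub n k},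
    arrangement_of_largest_minors R J' -> J \subset J' -> J' = J.

(* W is a (>= t, J)-largest minor; the indices excluded are the i <= l with
   i >= l - t + 2. *)
Definition ge_largest_minor (R : realType) n k (t : nat)
    (J : {set ksub n k}) (W : ksub n k) : Prop :=
  forall l (U : 'I_l.+1 -> {set ksub n k}),
    arrangement_of_minors R U -> U ord_max = J ->
    forall i : 'I_l.+1, (l + 2 <= i + t)%N -> W \notin U i.

End Minors.

(* The sequence a_1 <= ... <= a_2k; a_j is at position j - 1. *)
Definition merged n (I J : {set 'I_n}) : seq 'I_n :=
  sort (fun x y : 'I_n => x <= y) (enum I ++ enum J).

Definition Sort1 n k (I J : ksub n k) : {set 'I_n} :=
  [set x | [exists m : 'I_k, onth (merged (val I) (val J)) m.*2 == Some x]].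

Definition Sort2 n k (I J : ksub n k) : {set 'I_n} :=
  [set x | [exists m : 'I_k, onth (merged (val I) (val J)) m.*2.+1 == Some x]].

Definition sorted_pair n k (I J : ksub n k) : bool :=
  [set val I; val J] == [set Sort1 I J; Sort2 I J].

Definition sorted_collection n k (C : {set ksub n k}) : bool :=
  [forall I in C, forall J in C, sorted_pair I J].

Definition max_sorted n k (C : {set ksub n k}) : bool :=
  maxset (@sorted_collection n k) C.

Definition Gamma_adj n k (C D : {set ksub n k}) : bool :=
  [&& max_sorted C, max_sorted D, C != D & #|C :&: D| == n.-1].

Definition hypercube_adj m (x y : {ffun 'I_m -> bool}) : bool :=
  #|[set i | x i != y i]| == 1.

(* A subgraph of Gamma isomorphic to the m-cube graph, not necessarily induced,
   is the image of an injective graph homomorphism f from the m-cube graph. *)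
Definition is_cube n k m (f : {ffun 'I_m -> bool} -> {set ksub n k}) : Prop :=
  [/\ 1 <= m, injective f
    & forall x y, hypercube_adj x y -> Gamma_adj (f x) (f y)].

Definition on_common_cube n k (C D : {set ksub n k}) : Prop :=
  exists m (f : {ffun 'I_m -> bool} -> {set ksub n k}),
    is_cube f /\ exists x y, f x = C /\ f y = D.

Definition cube_path n k (D : nat) (C1 C2 : {set ksub n k}) : Prop :=
  exists c : nat -> {set ksub n k},
    [/\ c 0 = C1, c D = C2, forall i, i <= D -> max_sorted (c i)
      & forall i, i < D -> on_common_cube (c i) (c i.+1)].

Definition is_minimum (P : nat -> Prop) (d : nat) : Prop :=
  P d /\ forall d', P d' -> d <= d'.

(* [cube_d C1 C2 d] reads cube_d(C1, C2) = d. *)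
Definition cube_d n k (C1 C2 : {set ksub n k}) (d : nat) : Prop :=
  is_minimum (fun D => cube_path D C1 C2) d.

(* [cube_d_minor C W d] reads cube_d(C, W) = d. *)
Definition cube_d_minor n k (C : {set ksub n k}) (W : ksub n k) (d : nat) :
    Prop :=
  is_minimum
    (fun D => exists C2, [/\ max_sorted C2, W \in C2 & cube_d C C2 D]) d.

(* Main.v *)
Require Import Defs.
From mathcomp Require Import all_boot all_order all_algebra all_fingroup.
From mathcomp Require Import reals boolp zify ring lra.

(* Encode a k-subset I by its height function z_I(a) = #{x in I | x < a}, read
   n-periodically up to the shift z(a + n) = z(a) + k. For two such functions x
   <= y with x(a) = y(a), three-term Pluecker relations along a chain of unit
   steps from x to y give
     Delta(x + e_a) Delta(y) <= Delta(x) Delta(y + e_a), strictly if x <> y.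
   Maximal sorted collections are the vertex sets of the alcoves, an alcove
   being recorded by n times the heights Y of its barycenter, whose residues
   modulo n are distinct. Relative to Y, a subset W is recorded by its excesses
   E(a) = n z_W(a) - Y(a): it is a vertex of the alcove iff they all lie within
   a window of length n. If it is not, then the exchange inequality with a vertex
   of the alcove, whose minor is the largest, shows that Delta_W increases when
   the least excess is raised by n, or the largest is lowered by n. If N(b) is
   the number of excesses below E(b) - n plus the number of those above E(b),
   this puts W at least N(b) levels below the top whenever some excess is below
   E(b) - n, and at least 3 levels below it as soon as two excesses differ by 2n
   or more; the latter is impossible for k = 2.
   When all differences are less than 2n, crossing at once all the walls that
   exchange labels whose excesses differ by n + 1 is a move along a cube which
   decreases max N by at least 1 (a parallel bubble sort). So W is reached within
   max N cubes, which is at most the number of levels above W. *)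

Set Implicit Arguments.
Unset Strict Implicit.
Unset Printing Implicit Defensive.

Import Order.TTheory GRing.Theory Num.Theory.
Local Open Scope ring_scope.

(** * Three-term Pluecker inequalities *)

Lemma det_2x2 (R : comNzRingType) (M : 'M[R]_2) :
  \det M = M 0 0 * M 1 1 - M 0 1 * M 1 0.
Proof.
rewrite (expand_det_row _ 0) !big_ord_recl big_ord0 addr0 /cofactor !det_mx11.
rewrite !mxE /= /bump /= expr0 expr1 mul1r mulN1r mulrN.
by congr (_ * M _ _ - M _ _ * M _ _); apply/val_inj.
Qed.

Definition append_cols (R : Type) p q n (B : 'M[R]_(p, q)) (A : 'M[R]_(p, n))
    (x y : 'I_n) : 'M[R]_(p, q + (1 + 1)) :=
  row_mx B (row_mx (col x A) (col y A)).

(* Modulo the fixed columns [B], the columns of [A] live in a plane, in which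
   the determinant is the area form. *)
Lemma det_append_cols (F : fieldType) q n
    (B : 'M[F]_(q + (1 + 1), q)) (A : 'M[F]_(q + (1 + 1), n)) (x0 y0 : 'I_n) :
  \det (append_cols B A x0 y0) != 0 ->
  exists u v : 'I_n -> F, forall x y,
    \det (append_cols B A x y) =
    \det (append_cols B A x0 y0) * (u x * v y - v x * u y).
Proof.
set M0 := append_cols B A x0 y0 => M0_neq0.
have M0_unit : M0 \in unitmx by rewrite unitmxE unitfE.
(* Multiplication by the inverse of the reference matrix turns [B] into an identity block over zero,
   which leaves the determinant of a 2 x 2 block. *)
pose T := invmx M0; pose A' := dsubmx (T *m A).
have TB : T *m B = col_mx 1%:M 0.
  have : T *m M0 = 1%:M := mulVmx M0_unit.
  rewrite /M0 /append_cols mul_mx_row.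
  by rewrite scalar_mx_block block_mxEh => /eq_row_mx[].
exists (fun x => A' 0 x), (fun x => A' 1 x) => x y.
have -> : append_cols B A x y = M0 *m (T *m append_cols B A x y).
  by rewrite mulmxA mulmxV // mul1mx.
rewrite det_mulmx; congr (_ * _).
rewrite /append_cols mul_mx_row TB -[T *m row_mx _ _]vsubmxK -block_mxEh.
rewrite det_ublock det1 mul1r det_2x2.
have eN i j : dsubmx (T *m row_mx (col x A) (col y A)) i j =
    A' i (if j == 0 then x else y).
  rewrite !mxE; apply: eq_bigr => l _; rewrite !mxE; congr (_ * _).
  case: splitP => j' ej; rewrite (ord1 j') /= in ej.
    by rewrite mxE (_ : j == 0) //; apply/eqP/val_inj.
  by rewrite mxE ifN //; apply/eqP => /(congr1 (@nat_of_ord _)); rewrite ej.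
by rewrite !eN /=; ring.
Qed.

(** In the plane modulo [B] this is the quadratic identity between area forms; the nonzero minor at
    [x], [z] supplies the coordinates. *)
Lemma three_term_append_cols (F : fieldType) q n
    (B : 'M[F]_(q + (1 + 1), q)) (A : 'M[F]_(q + (1 + 1), n))
    (x y z w : 'I_n) (p := fun x y => \det (append_cols B A x y)) :
  p x z != 0 -> p x z * p y w = p x y * p z w + p x w * p y z.
Proof.
move=> /det_append_cols[u [v]]; move: (\det (append_cols B A x z)) => D puv.
by rewrite /p !puv; ring.
Qed.

Definition append_idx q n (s : 'I_q -> 'I_n) (x y : 'I_n)
    (i : 'I_(q + (1 + 1))) : 'I_n :=
  match split i with inl l => s l | inr j => if j == 0 then x else y end.

Lemma append_idx_lshift q n (s : 'I_q -> 'I_n) x y l :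
  append_idx s x y (lshift _ l) = s l.
Proof. by rewrite /append_idx (unsplitK (inl l)). Qed.

Lemma append_idx_rshift q n (s : 'I_q -> 'I_n) x y j :
  append_idx s x y (rshift _ j) = if j == 0 then x else y.
Proof. by rewrite /append_idx (unsplitK (inr j)). Qed.

Lemma append_cols_colsub (R : Type) q n
    (A : 'M[R]_(q + (1 + 1), n)) (s : 'I_q -> 'I_n) x y :
  append_cols (colsub s A) A x y = colsub (append_idx s x y) A.
Proof.
apply/matrixP => i j; rewrite -[j]splitK; case: (split j) => {}j /=.
  by rewrite row_mxEl !mxE append_idx_lshift.
rewrite row_mxEr !mxE append_idx_rshift; case: splitP => l el; rewrite (ord1 l) in el *.
  by rewrite (_ : j == 0) ?mxE //; apply/eqP/val_inj.
by rewrite ifN ?mxE //; apply/eqP => /(congr1 (@nat_of_ord _)); rewrite el.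
Qed.

(** The sign is chosen before [A]: it depends only on the order of the columns, so it can be read
    off a Vandermonde matrix. *)
Lemma det_colsub_perm (R : comNzRingType) n k (I : ksub n k) (g : 'I_k -> 'I_n) :
  injective g -> (forall j, g j \in val I) ->
  exists e : bool, forall A : 'M[R]_(k, n),
    \det (colsub g A) = (-1) ^+ e * \det (colsub (column I) A).
Proof.
move=> g_inj gI.
pose f j := cast_ord (eqP (valP I)) (enum_rank_in (gI j) (g j)).
have colf j : column I (f j) = g j.
  by rewrite /column /f cast_ordK enum_rankK_in.
have f_inj : injective f by move=> i j eij; apply: g_inj; rewrite -!colf eij.
exists (odd_perm (perm f_inj)) => A.
have -> : colsub g A = col_perm (perm f_inj) (colsub (column I) A).
  by apply/matrixP => i j; rewrite !mxE permE colf.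
by rewrite col_permE det_mulmx det_perm odd_permV mulrC.
Qed.

(** * Signs of minors with reordered columns *)

Section Signs.
Variable R : realType.

(** A test matrix: its nodes increase, so its maximal minors are positive and it reveals the sign of
    a reordering. *)
Definition vand k n : 'M[R]_(k, n) := Vandermonde k (\row_(j < n) (j : nat)%:R).

Lemma det_colsub_vand k n (g : 'I_k -> 'I_n) :
  \det (colsub g (vand k n)) =
  \prod_(i < k) \prod_(j < k | (i < j)%N) ((g j : nat)%:R - (g i : nat)%:R).
Proof.
have -> : colsub g (vand k n) = Vandermonde k (\row_j (g j : nat)%:R).
  by apply/matrixP => i j; rewrite !mxE.
rewrite det_Vandermonde; apply: eq_bigr => i _; apply: eq_bigr => j _.
by rewrite !mxE.
Qed.

Lemma det_colsub_vand_gt0 k n (g : 'I_k -> 'I_n) :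
  (forall i j : 'I_k, (i < j)%N -> (g i < g j)%N) -> 0 < \det (colsub g (vand k n)).
Proof.
move=> g_mono; rewrite det_colsub_vand; apply: prodr_gt0 => i _.
by apply: prodr_gt0 => j ij; rewrite subr_gt0 ltr_nat g_mono.
Qed.

(** The factors between [x] or [y] and the columns of [s] are collected in [G]. Hence, for two
    minors that together use four given indices once each, only the differences depend on the
    pairing. *)
Lemma vand_append_idx q n (s : 'I_q -> 'I_n) :
  exists (C : R) (G : 'I_n -> R), forall x y,
    \det (colsub (append_idx s x y) (vand (q + (1 + 1)) n)) =
    C * G x * G y * ((y : nat)%:R - (x : nat)%:R).
Proof.
exists (\prod_(l < q) \prod_(j < q | (l < j)%N) ((s j : nat)%:R - (s l : nat)%:R)).
exists (fun x => \prod_(l < q) ((x : nat)%:R - (s l : nat)%:R)) => x y.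
rewrite det_colsub_vand big_split_ord /= [X in _ * X]big_ord_recl big_ord1.
rewrite -!big_split; congr (_ * _) => /=.
  apply: eq_bigr => l _; rewrite big_split_ord /= append_idx_lshift -mulrA.
  congr (_ * _).
    by apply: eq_bigr => j _; rewrite append_idx_lshift.
  under eq_bigl => j do rewrite (leq_trans (ltn_ord l) (leq_addr _ _)).
  by rewrite big_ord_recl big_ord1 !append_idx_rshift.
rewrite [X in _ * X]big_pred0 ?mulr1 => [|j]; last first.
  by apply/negbTE; rewrite -leqNgt /= /bump /=; have := ltn_ord j; lia.
rewrite big_split_ord /= big_pred0 ?mul1r => [|j]; last first.
  by apply/negbTE; rewrite -leqNgt /= /bump /=; have := ltn_ord j; lia.
rewrite big_mkcond big_ord_recl big_ord1 !append_idx_rshift /=.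
have -> : (q + 0 < q + 0)%N = false by lia.
have -> : (q + 0 < q + bump 0 0)%N by rewrite /bump /=; lia.
by rewrite mul1r.
Qed.

(** The Pluecker relation writes the product of the crossing pair as the sum of the two other
    products, and all three are positive. Appending two columns to those of [S] disturbs the order
    of the columns, but the three products acquire the same sign [c]. *)
Lemma three_term_lt n k (A : 'M[R]_(k, n)) (S : {set 'I_n}) (x y z w : 'I_n)
    (Ixy Ixz Ixw Iyz Iyw Izw : ksub n k) :
  (forall I, 0 < Delta A I) ->
  x \notin S -> y \notin S -> z \notin S -> w \notin S ->
  (x < y)%N -> (y < z)%N -> (z < w)%N ->
  val Ixy = x |: (y |: S) -> val Ixz = x |: (z |: S) ->
  val Ixw = x |: (w |: S) -> val Iyz = y |: (z |: S) ->
  val Iyw = y |: (w |: S) -> val Izw = z |: (w |: S) ->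
  Delta A Ixy * Delta A Izw < Delta A Ixz * Delta A Iyw /\
  Delta A Ixw * Delta A Iyz < Delta A Ixz * Delta A Iyw.
Proof.
move=> A_gt0 xS yS zS wS xy yz zw exy exz exw eyz eyw ezw.
have ek : k = (#|S| + (1 + 1))%N.
  have := valP Ixy; rewrite exy => /eqP <-; rewrite !cardsU1 yS !inE (negbTE xS).
  by rewrite orbF (_ : x == y = false) ?addnA; [lia|apply/eqP => exy'; subst; lia].
subst k; set q := #|S| in A A_gt0 Ixy Ixz Ixw Iyz Iyw Izw exy exz exw eyz eyw ezw *.
pose s : 'I_q -> 'I_n := fun l => enum_val l.
have s_inj : injective s by apply: enum_val_inj.
have sS l : s l \in S by apply: enum_valP.
pose p (a b : 'I_n) := \det (colsub (append_idx s a b) A).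
pose v (a b : 'I_n) := \det (colsub (append_idx s a b) (vand (q + (1 + 1)) n)).
have signs (a b : 'I_n) (I : ksub n (q + (1 + 1))) :
    a \notin S -> b \notin S -> (a < b)%N -> val I = a |: (b |: S) ->
    exists e : bool, p a b = (-1) ^+ e * Delta A I /\ Num.sg (v a b) = (-1) ^+ e.
  move=> aS bS ab eI.
  have g_inj : injective (append_idx s a b).
    have neq_ab : a != b by apply/eqP => eab; subst; lia.
    move=> i j; rewrite -[i]splitK -[j]splitK.
    case: (split i) => {}i; case: (split j) => {}j /=;
      rewrite ?append_idx_lshift ?append_idx_rshift.
    - by move/s_inj->.
    - by case: eqP => _ eqs; have := sS i; rewrite eqs ?(negbTE aS) ?(negbTE bS).
    - by case: eqP => _ eqs; have := sS j; rewrite -eqs ?(negbTE aS) ?(negbTE bS).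
    move: i j => [[|[|i]] Hi] [[|[|j]] Hj] //=; rewrite ?eqE /= => eab;
      rewrite ?eab ?eqxx in neq_ab => //; congr rshift; exact: val_inj.
  have gI j : append_idx s a b j \in val I.
    rewrite -[j]splitK eI !inE; case: (split j) => {}j /=.
      by rewrite append_idx_lshift sS !orbT.
    by rewrite append_idx_rshift; case: ifP => _; rewrite eqxx ?orbT.
  have [e He] := det_colsub_perm R g_inj gI.
  exists e; split; first exact: He.
  rewrite /v He sgrM sgrX sgrN1 gtr0_sg ?mulr1 //.
  by apply: det_colsub_vand_gt0 => i j; apply: column_increasing.
have plucker : p x z * p y w = p x y * p z w + p x w * p y z.
  rewrite /p -!append_cols_colsub; apply: three_term_append_cols.
  rewrite append_cols_colsub -/(p x z).
  have [e [-> _]] := signs x z Ixz xS zS (ltn_trans xy yz) exz.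
  by rewrite mulf_neq0 ?signr_eq0 // gt_eqF.
have [C [G vE]] := vand_append_idx s.
pose c := Num.sg (C * C * G x * G y * G z * G w).
have cE (a b d e : 'I_n) : (a < b)%N -> (d < e)%N ->
    G a * G b * (G d * G e) = G x * G y * (G z * G w) ->
    Num.sg (v a b) * Num.sg (v d e) = c.
  move=> ab de eG; rewrite -sgrM /v !vE.
  rewrite [X in Num.sg X](_ : _ = C * C * (G a * G b * (G d * G e)) *
    (((b : nat)%:R - (a : nat)%:R) * ((e : nat)%:R - (d : nat)%:R))); last by ring.
  rewrite sgrM [X in _ * X]gtr0_sg ?mulr1; last by rewrite mulr_gt0 ?subr_gt0 ?ltr_nat.
  by rewrite eG /c; congr Num.sg; ring.
have [e1 [p1 s1]] := signs x y Ixy xS yS xy exy.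
have [e2 [p2 s2]] := signs z w Izw zS wS zw ezw.
have [e3 [p3 s3]] := signs x z Ixz xS zS (ltn_trans xy yz) exz.
have [e4 [p4 s4]] := signs y w Iyw yS wS (ltn_trans yz zw) eyw.
have [e5 [p5 s5]] := signs x w Ixw xS wS (ltn_trans (ltn_trans xy yz) zw) exw.
have [e6 [p6 s6]] := signs y z Iyz yS zS yz eyz.
have c12 := cE x y z w xy zw erefl.
have c34 := cE x z y w (ltn_trans xy yz) (ltn_trans yz zw) (mulrACA _ _ _ _).
have c56 : Num.sg (v x w) * Num.sg (v y z) = c.
  by apply: cE => //; [rewrite (ltn_trans (ltn_trans xy yz))|rewrite [G z * _]mulrC mulrACA].
rewrite s1 s2 in c12; rewrite s3 s4 in c34; rewrite s5 s6 in c56.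
have c_neq0 : c != 0 by rewrite -c12 mulf_neq0 ?signr_eq0.
have : Delta A Ixz * Delta A Iyw =
    Delta A Ixy * Delta A Izw + Delta A Ixw * Delta A Iyz.
  apply: (mulfI c_neq0); rewrite mulrDr -{1}c34 -{1}c12 -c56.
  by move: plucker; rewrite p1 p2 p3 p4 p5 p6 => plucker;
     rewrite mulrACA plucker; ring.
have gt0 I I' : 0 < Delta A I * Delta A I' by rewrite mulr_gt0.
by have := gt0 Ixy Izw; have := gt0 Ixw Iyz; lra.
Qed.

End Signs.

(** * Height functions of k-subsets *)

Definition twist n (K : nat) (a : 'I_n) : int := if a.+1 == n then K%:Z else 0.

(* [incr K z a] is the increment from [a] to [a + 1] of the extension of [z] to
   the integers for which z (a + n) = z a + K. *)
Definition incr n (K : nat) (z : 'I_n -> int) (a : 'I_n) : int :=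
  z (ordS a) + twist K a - z a.

Lemma val_ordS n (a : 'I_n) : ordS a = (if a.+1 == n then 0 else a.+1) :> nat.
Proof.
rewrite /=; case: eqP => [->|/eqP neq]; first by rewrite modnn.
by rewrite modn_small // ltn_neqAle neq ltn_ord.
Qed.

Lemma sum_incr n K (z : 'I_n -> int) : (0 < n)%N -> \sum_a incr K z a = K%:Z.
Proof.
case: n z => // n z _; rewrite /incr !big_split /= sumrN.
rewrite [X in _ - X](reindex (@ordS n.+1)) /=; last exact/onW_bij/ordS_bij.
rewrite addrAC subrr add0r (bigD1 ord_max) //= big1 => [|a a_max].
  by rewrite addr0 /twist eqxx.
rewrite /twist ifF //; apply: contraNF a_max => /eqP[ea].
exact/eqP/val_inj.
Qed.

Lemma ordS_const n (d : 'I_n -> int) :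
  (forall a, d (ordS a) = d a) -> forall a b, d a = d b.
Proof.
move=> dS; suff d0 (a b : 'I_n) : b = 0%N :> nat -> d a = d b.
  move=> a b; have n_gt0 : (0 < n)%N by apply: leq_trans (ltn_ord a).
  by rewrite (d0 a (Ordinal n_gt0)) // (d0 b (Ordinal n_gt0)).
move=> b0; case: a => m; elim: m => [|m IHm] lt_m; first by congr d; apply: val_inj.
rewrite -(IHm (ltnW lt_m)) -[RHS]dS; congr d; apply: val_inj.
by rewrite /= modn_small.
Qed.

(** As the increments add up to [k], these are, for positive [n], the height functions of k-subsets
    up to an additive constant. *)
Definition profile n k (z : 'I_n -> int) : Prop := forall a, 0 <= incr k z a <= 1.

(** Heights matter only up to an additive constant, which leaves room to normalize one value. *)
Definition represents n k (z : 'I_n -> int) (I : ksub n k) : Prop :=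
  forall a, incr k z a = (a \in val I)%:Z.

Lemma represents_ext n k (z z' : 'I_n -> int) (I : ksub n k) :
  z =1 z' -> represents z I -> represents z' I.
Proof. by move=> ez zI a; rewrite -zI /incr !ez. Qed.

Lemma represents_profile n k z (I : ksub n k) : represents z I -> profile k z.
Proof. by move=> zI a; rewrite zI; case: (_ \in _). Qed.

Lemma profile_represents n k z :
  (0 < n)%N -> profile k z -> exists I : ksub n k, represents z I.
Proof.
move=> n_gt0 zP; pose I := [set a | incr k z a == 1].
have zI a : incr k z a = (a \in I)%:Z.
  by rewrite inE; have := zP a; case: eqP => //=; lia.
have cardI : #|I| == k.
  have := sum_incr k z n_gt0; rewrite (eq_bigr _ (fun a _ => zI a)).
  rewrite -(big_morph Posz PoszD erefl) => -[<-]; rewrite -sum1_card big_mkcond.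
  by apply/eqP; apply: eq_bigr => a _; case: (a \in I).
by exists (exist _ I cardI).
Qed.

Lemma represents_inj n k z (I I' : ksub n k) :
  represents z I -> represents z I' -> I = I'.
Proof.
move=> zI zI'; apply/val_inj/setP => a; have := zI a; rewrite zI'.
by do 2!case: (_ \in _).
Qed.

Lemma represents_shift n k z z' (I : ksub n k) :
  represents z I -> represents z' I -> forall a b, z' a - z a = z' b - z b.
Proof.
move=> zI z'I; apply: (ordS_const (d := fun a => z' a - z a)) => a.
by have := zI a; rewrite -z'I /incr; lia.
Qed.

Lemma represents_addr n k z c (I : ksub n k) :
  represents z I -> represents (fun a => z a + c) I.
Proof. by move=> zI a; rewrite -zI /incr; lia. Qed.

Definition count_below n (S : {set 'I_n}) (a : nat) : nat :=
  #|[set x in S | (x < a)%N]|.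

Lemma count_belowS n (S : {set 'I_n}) (x : 'I_n) :
  count_below S x.+1 = ((x \in S) + count_below S x)%N.
Proof.
rewrite /count_below (cardsD1 x) !inE ltnSn andbT; congr (_ + _)%N.
apply: eq_card => y; rewrite !inE ltnS ltn_neqAle -(inj_eq val_inj).
by rewrite andbCA.
Qed.

Lemma count_below_top n k (I : ksub n k) a : (n <= a)%N -> count_below (val I) a = k.
Proof.
move=> na; have /eqP cardI := valP I; rewrite /count_below -[RHS]cardI.
by apply: eq_card => x; rewrite inE (leq_trans (ltn_ord x) na) andbT.
Qed.

Lemma count_below0 n (S : {set 'I_n}) : count_below S 0 = 0%N.
Proof. by apply: eq_card0 => x; rewrite !inE andbF. Qed.

Definition height n k (I : ksub n k) (a : 'I_n) : int := (count_below (val I) a)%:Z.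

Lemma height_represents n k (I : ksub n k) : represents (height I) I.
Proof.
move=> a; rewrite /incr /height /twist val_ordS.
have cS := count_belowS (val I) a; case: eqP => [ea|_]; last by rewrite cS PoszD; ring.
rewrite ea (count_below_top I (leqnn n)) in cS.
by rewrite count_below0 [in k%:Z]cS PoszD; ring.
Qed.

Lemma height_bounds n k (I : ksub n k) a : 0 <= height I a <= k%:Z.
Proof.
have /eqP cardI := valP I; rewrite /height /= lez_nat -[leqRHS]cardI subset_leq_card //.
by apply/subsetP => x; rewrite inE => /andP[].
Qed.

Lemma height_mono n k (I : ksub n k) (a b : 'I_n) :
  (a <= b)%N -> height I a <= height I b.
Proof.
move=> ab; rewrite lez_nat; apply: subset_leq_card; apply/subsetP => x.
by rewrite !inE => /andP[-> /leq_trans->].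
Qed.

(** When the result is again a profile, the subset loses [a] and gains its cyclic predecessor. *)
Definition raise n (a : 'I_n) (z : 'I_n -> int) : 'I_n -> int :=
  fun b => z b + (b == a)%:Z.

Lemma incr_raise n K (a : 'I_n) z c :
  incr K (raise a z) c = incr K z c + (ordS c == a)%:Z - (c == a)%:Z.
Proof. by rewrite /incr /raise; lia. Qed.

Lemma profile_min n k (z z' : 'I_n -> int) : profile k z -> profile k z' ->
  profile k (fun a => Num.min (z a) (z' a)).
Proof. by move=> zP z'P a; have := zP a; have := z'P a; rewrite /incr; lia. Qed.

Lemma profile_max n k (z z' : 'I_n -> int) : profile k z -> profile k z' ->
  profile k (fun a => Num.max (z a) (z' a)).
Proof. by move=> zP z'P a; have := zP a; have := z'P a; rewrite /incr; lia. Qed.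

(** If [a] can be raised in both [x] and [y], equality at [a] forces equality at both neighbours, so
    [w] agrees with them there. *)
Lemma profile_raise_between n k (a : 'I_n) (x w y : 'I_n -> int) :
  profile k (raise a x) -> profile k (raise a y) -> profile k w ->
  profile k x -> profile k y ->
  (forall c, x c <= w c <= y c) -> x a = y a -> profile k (raise a w).
Proof.
move=> xaP yaP wP xP yP xwy xya c.
have := xaP c; have := yaP c; have := wP c; have := xP c; have := yP c.
have := xwy (ordS c); have := xwy c; rewrite !incr_raise /incr.
move: xya; have [<-|_] := eqVneq (ordS c) a; have [ca|_] := eqVneq c a;
  rewrite ?ca; lia.
Qed.

(** Supplies the unit steps of a chain of profiles from [x] up to [y]; the minimizer of [phi] is the
    index to raise. *)
Lemma exists_raise n k (x y : 'I_n -> int) c : (0 < k < n)%N ->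
  profile k x -> profile k y -> (forall a, x a <= y a) -> x c < y c ->
  exists2 b, x b < y b & profile k (raise b x).
Proof.
move=> /andP[k_gt0 k_ltn] xP yP xy xyc.
(* Both a step to the right along a flat part of [x] and a step to the left
   along a rising part stay in [x < y] and decrease [phi]. *)
pose phi (b : 'I_n) : int := n%:Z * x b - k%:Z * (b : nat)%:Z.
have phiS b : phi (ordS b) = phi b + n%:Z * incr k x b - k%:Z.
  rewrite /phi /incr /twist val_ordS; case: eqP => [eb|_]; last by lia.
  by have -> : (b : nat)%:Z = n%:Z - 1; lia.
case: (@Order.TotalTheory.arg_minP _ _ _ c (fun b => x b < y b) phi xyc) => b xyb b_min.
exists b => //.
have incr_b : incr k x b = 1.
  have := xP b; have := yP b; have := phiS b; have := b_min (ordS b).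
  rewrite /incr; case: (ltP (x (ordS b)) (y (ordS b))) => [_ /(_ isT)|]; nia.
have [p pb] : exists p, ordS p = b by exists (ord_pred b); rewrite ord_predK.
have incr_p : incr k x p = 0.
  have := xP p; have := yP p; have := phiS p; have := b_min p.
  rewrite /incr pb; case: (ltP (x p) (y p)) => [_ /(_ isT)|]; nia.
move=> d; rewrite incr_raise; have := xP d.
have [->|db] := eqVneq d b; first by rewrite incr_b; case: (_ == _).
have [edb|_] := eqVneq (ordS d) b; last by rewrite subr0 addr0.
by rewrite (_ : d = p) ?incr_p //; apply: ordS_inj; rewrite edb.
Qed.

(** * Exchange inequality for minors *)

Lemma val_ord_pred n (a : 'I_n) :
  ord_pred a = (if (a : nat) == 0 then n.-1 else a.-1) :> nat.
Proof.
have lt_an := ltn_ord a; rewrite /=; case: eqP => [->|/eqP a_neq0].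
  by rewrite add0n modn_small //; lia.
by rewrite (_ : (a + n).-1 = a.-1 + n)%N ?modnDr ?modn_small //; lia.
Qed.

Lemma exists_ksub2 n k (S : {set 'I_n}) (x y : 'I_n) :
  x \notin S -> y \notin S -> x != y -> k = #|S|.+2 ->
  exists I : ksub n k, val I = x |: (y |: S).
Proof.
move=> xS yS xy ek.
have cardI : #|x |: (y |: S)| == k.
  by rewrite !cardsU1 !inE (negbTE xS) (negbTE yS) (negbTE xy) ek.
by exists (exist (fun I : {set 'I_n} => #|I| == k) _ cardI).
Qed.

Section Exchange.
Variables (R : realType) (n k : nat) (A : 'M[R]_(k, n)).
Hypothesis A_gt0 : forall I, 0 < Delta A I.

(** The raises replace [a] and [b] by their predecessors [p] and [q]. In the cyclic order p, a, q, b
    the pairs [a], [b] and [p], [q] cross, so their product is the larger one in the three-term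
    relation. *)
Lemma Delta_raise_raise (a b : 'I_n) z (I Ia Ib Iab : ksub n k) :
  a != b -> represents z I -> represents (raise a z) Ia ->
  represents (raise b z) Ib -> represents (raise a (raise b z)) Iab ->
  Delta A Ia * Delta A Ib < Delta A I * Delta A Iab.
Proof.
wlog : a b Ia Ib / (a < b)%N => [Hwlog ab zI zIa zIb zIab|lt_ab ab zI zIa zIb zIab].
  have [lt_ab|lt_ba|eab] := ltngtP a b; first exact: Hwlog lt_ab _ _ _ _ _.
    rewrite mulrC; apply: Hwlog lt_ba _ zI zIb zIa _; first by rewrite eq_sym.
    by apply: represents_ext zIab => c; rewrite /raise; lia.
  by case/eqP: ab; apply: val_inj.
pose p := ord_pred a; pose q := ord_pred b.
have vp := val_ord_pred a; have vq := val_ord_pred b.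
rewrite -/p -/q in vp vq.
have ltbn := ltn_ord b; have ltpn := ltn_ord p.
have ltqb : (q < b)%N by rewrite vq ifN; lia.
have lt_aq : a != q -> (a < q)%N.
  by rewrite -(inj_eq (@ord_inj n)) vq ifN; lia.
have lt_bp : b != p -> (a : nat) = 0%N -> (b < p)%N.
  by rewrite -(inj_eq (@ord_inj n)) => nbp a0; move: nbp; rewrite vp a0 eqxx; lia.
have ltpa : (a : nat) != 0%N -> (p < a)%N by move=> a0; rewrite vp ifN //; lia.
have neq_ap : a != p.
  apply/eqP => eap; move/(congr1 (@nat_of_ord _)): eap.
  by rewrite vp; case: eqP; lia.
have neq_bq : b != q by rewrite -(inj_eq val_inj) neq_ltn ltqb orbT.
have inIa c : (c \in val Ia)%:Z = (c \in val I)%:Z + (c == p)%:Z - (c == a)%:Z :> int.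
  by rewrite -zIa -zI incr_raise (can2_eq (@ordSK n) (@ord_predK n)).
have inIb c : (c \in val Ib)%:Z = (c \in val I)%:Z + (c == q)%:Z - (c == b)%:Z :> int.
  by rewrite -zIb -zI incr_raise (can2_eq (@ordSK n) (@ord_predK n)).
have inIab c : (c \in val Iab)%:Z =
    (c \in val Ib)%:Z + (c == p)%:Z - (c == a)%:Z :> int.
  by rewrite -zIb -zIab incr_raise (can2_eq (@ordSK n) (@ord_predK n)).
have aI : a \in val I.
  by have := inIa a; rewrite eqxx (negbTE neq_ap); case: (a \in val I); case: (_ \in _).
have bI : b \in val I.
  by have := inIb b; rewrite eqxx (negbTE neq_bq); case: (b \in val I); case: (_ \in _).
have pI : p \notin val I.
  have := inIa p; rewrite eqxx eq_sym (negbTE neq_ap).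
  by case: (p \in val I); case: (_ \in _).
have qI : q \notin val I.
  have := inIb q; rewrite eqxx eq_sym (negbTE neq_bq).
  by case: (q \in val I); case: (_ \in _).
have neq_aq : a != q by apply: contraNneq qI => <-.
have neq_bp : b != p by apply: contraNneq pI => <-.
have neq_pq : p != q by rewrite (inj_eq (@ord_pred_inj n)).
pose S := val I :\ a :\ b.
have aS : a \notin S by rewrite !inE eqxx andbF.
have bS : b \notin S by rewrite !inE eqxx.
have pS : p \notin S by rewrite !inE (negbTE pI) !andbF.
have qS : q \notin S by rewrite !inE (negbTE qI) !andbF.
have cardS : k = #|S|.+2.
  have /eqP := valP I; rewrite (cardsD1 a) aI (cardsD1 b) !inE bI.
  by rewrite (eq_sym b) ab => cardI; rewrite -[LHS]cardI.
have eI : val I = a |: (b |: S).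
  by rewrite /S !setD1K // !inE (eq_sym b) ab bI.
have eIa : val Ia = p |: (b |: S).
  apply/setP => c; have := inIa c; rewrite !inE.
  have [->|_] := eqVneq c a; first by rewrite (negbTE neq_ap) (negbTE ab) aI; case: (_ \in _).
  have [->|_] := eqVneq c p; first by rewrite (negbTE pI); case: (_ \in _).
  have [->|_] := eqVneq c b; first by rewrite bI; case: (_ \in _).
  by case: (c \in val I); case: (_ \in _).
have eIb : val Ib = a |: (q |: S).
  apply/setP => c; have := inIb c; rewrite !inE.
  have [->|_] := eqVneq c a; first by rewrite (negbTE neq_aq) (negbTE ab) aI; case: (_ \in _).
  have [->|_] := eqVneq c q; first by rewrite (negbTE qI) eq_sym (negbTE neq_bq); case: (_ \in _).
  have [->|_] := eqVneq c b; first by rewrite bI; case: (_ \in _).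
  by case: (c \in val I); case: (_ \in _).
have eIab : val Iab = p |: (q |: S).
  apply/setP => c; have := inIab c; rewrite eIb !inE.
  have [->|_] := eqVneq c a; first
    by rewrite (negbTE neq_ap) (negbTE neq_aq) /= andbF; case: (_ \in _).
  have [->|_] := eqVneq c p.
    by rewrite (negbTE pI) (negbTE neq_pq) /= andbF; case: (_ \in _).
  by case: (c == q); case: [&& _, _ & _]; case: (_ \in _).
have neq_pa : p != a by rewrite eq_sym.
have neq_qb : q != b by rewrite eq_sym.
have [Ipa eIpa] := exists_ksub2 pS aS neq_pa cardS.
have [Iqb eIqb] := exists_ksub2 qS bS neq_qb cardS.
(* If [a] is the first index, its predecessor is the last one: the order is a < q < b < p instead of
   p < a < q < b, and the other one of the two inequalities applies. *)
have [a0|a_neq0] := eqVneq (a : nat) 0%N.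
  have [lt1 _] := three_term_lt A_gt0 aS qS bS pS (lt_aq neq_aq) ltqb (lt_bp neq_bp a0) eIb eI
    (etrans eIpa (setUCA _ _ _)) eIqb (etrans eIab (setUCA _ _ _))
    (etrans eIa (setUCA _ _ _)).
  by rewrite mulrC.
have [_ lt2] := three_term_lt A_gt0 pS aS qS bS (ltpa a_neq0) (lt_aq neq_aq) ltqb eIpa eIab eIa
  eIb eI eIqb.
by rewrite [X in _ < X]mulrC.
Qed.

(** The ratio of the minors at [raise a w] and at [w] grows strictly with every unit step of [w]
    from [x] towards [y]; the induction is on the number of steps. *)
Lemma Delta_exchange_le (a : 'I_n) (x y : 'I_n -> int) (Ix Ixa Iy Iya : ksub n k) :
  (0 < k < n)%N -> (forall c, x c <= y c) -> x a = y a ->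
  represents x Ix -> represents (raise a x) Ixa ->
  represents y Iy -> represents (raise a y) Iya ->
  Delta A Ixa * Delta A Iy <= Delta A Ix * Delta A Iya ?= iff [forall c, x c == y c].
Proof.
move=> kn; have n_gt0 : (0 < n)%N by lia.
move: {2}(absz _) (leqnn (absz (\sum_c (y c - x c)))) => m.
elim: m x Ix Ixa => [|m IHm] x Ix Ixa le_m xy xya xI xaI yI yaI.
  have exy : x =1 y.
    have [z0] : \sum_c (y c - x c) = 0 by lia.
    have /psumr_eq0P z1 : forall c, true -> 0 <= y c - x c by move=> c _; have := xy c; lia.
    by move=> c; have := z1 z0 c isT; lia.
  have -> : Ix = Iy by apply: represents_inj (represents_ext exy xI) yI.
  have -> : Ixa = Iya.
    by apply: represents_inj yaI; apply: represents_ext xaI => c; rewrite /raise exy.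
  rewrite mulrC; apply/leif_refl; apply/forallP => c; exact/eqP.
have [exy|] := boolP [forall c, x c == y c].
  have {}exy : x =1 y by move=> c; apply/eqP/(forallP exy).
  have -> : Ix = Iy by apply: represents_inj (represents_ext exy xI) yI.
  have -> : Ixa = Iya.
    by apply: represents_inj yaI; apply: represents_ext xaI => c; rewrite /raise exy.
  by rewrite mulrC; apply/leif_refl.
rewrite negb_forall => /existsP[c neq_c].
have [xP xaP] := (represents_profile xI, represents_profile xaI).
have [yP yaP] := (represents_profile yI, represents_profile yaI).
have ltc : x c < y c by have := xy c; lia.
have [b ltb xbP] := exists_raise kn xP yP xy ltc.
have neq_ab : a != b by apply: contraTneq ltb => <-; rewrite xya ltxx.
have between d : x d <= raise b x d <= y d.
  by rewrite /raise; have := xy d; have [->|_] := eqVneq d b; lia.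
have xbya : raise b x a = y a by rewrite /raise (negbTE neq_ab) addr0.
have [Ib xbI] := profile_represents n_gt0 xbP.
have [Iab xabI] := profile_represents n_gt0
  (profile_raise_between xaP yaP xbP xP yP between xya).
have le_sum : (absz (\sum_c (y c - raise b x c))%R <= m)%N.
  have : \sum_c (y c - raise b x c) = \sum_c (y c - x c) - 1.
    have e1 : \sum_(d < n) (d == b)%:Z = 1 :> int.
      by rewrite (bigD1 b) //= eqxx big1 // => d /negbTE->.
    by rewrite -[X in _ - X]e1 -sumrB; apply: eq_bigr => d _; rewrite /raise; lia.
  have : 0 <= \sum_c (y c - raise b x c).
    by apply: sumr_ge0 => d _; have := between d; lia.
  lia.
have [IH _] := IHm _ _ _ le_sum (fun d => proj2 (andP (between d))) xbya xbI xabI yI yaI.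
have step := Delta_raise_raise neq_ab xI xaI xbI xabI.
have lt1 : Delta A Ixa * Delta A Iy < Delta A Ix * Delta A Iya.
  rewrite -(ltr_pM2l (A_gt0 Ib)).
  have : Delta A Ixa * Delta A Ib * Delta A Iy <
      Delta A Ix * Delta A Iab * Delta A Iy by rewrite ltr_pM2r.
  have : Delta A Ix * (Delta A Iab * Delta A Iy) <=
      Delta A Ix * (Delta A Ib * Delta A Iya) by rewrite ler_pM2l.
  lra.
split; first exact: ltW.
by rewrite lt_eqF.
Qed.

Lemma Delta_exchange_lt (a c : 'I_n) (x y : 'I_n -> int) (Ix Ixa Iy Iya : ksub n k) :
  (0 < k < n)%N -> (forall c, x c <= y c) -> x a = y a -> x c < y c ->
  represents x Ix -> represents (raise a x) Ixa ->
  represents y Iy -> represents (raise a y) Iya ->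
  Delta A Ixa * Delta A Iy < Delta A Ix * Delta A Iya.
Proof.
move=> kn xy xya ltc xI xaI yI yaI.
have [le eq_le] := Delta_exchange_le kn xy xya xI xaI yI yaI.
rewrite lt_neqAle le eq_le andbT; apply/forallPn; exists c.
by rewrite lt_eqF.
Qed.

End Exchange.

(** * Alcoves and their vertices *)

(* An alcove of the affine arrangement refining the hypersimplex, given by [n]
   times the partial sums of the coordinates of its barycenter. *)
Definition alcove n k (Y : 'I_n -> int) : Prop :=
  (forall a, 0 < incr (n * k) Y a < n%:Z) /\
  (forall a b, (Y a %% n%:Z)%Z = (Y b %% n%:Z)%Z -> a = b).

Definition excess n (Y z : 'I_n -> int) (a : 'I_n) : int := n%:Z * z a - Y a.

Definition simplex n k (Y : 'I_n -> int) : {set ksub n k} :=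
  [set I | [forall a, forall b,
    excess Y (height I) a - excess Y (height I) b < n%:Z]].

Lemma mem_simplex n k (Y z : 'I_n -> int) (I : ksub n k) : represents z I ->
  reflect (forall a b, excess Y z a - excess Y z b < n%:Z) (I \in simplex k Y).
Proof.
move=> zI; have shift := represents_shift zI (height_represents I).
rewrite inE; apply: (iffP forallP) => H a.
  move=> b; have /forallP/(_ b) := H a.
  by have := shift a b; rewrite /excess; nia.
by apply/forallP => b; have := H a b; have := shift a b; rewrite /excess; nia.
Qed.

Lemma divz_bounds (n : nat) (x : int) : (0 < n)%N ->
  n%:Z * (x %/ n%:Z)%Z <= x < n%:Z * (x %/ n%:Z)%Z + n%:Z.
Proof.
move=> n_gt0; have n0 : n%:Z != 0 by lia.
have := divz_eq x n%:Z; have := modz_ge0 x n0.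
by have := ltz_mod x n0; lia.
Qed.

Lemma mulz_lt_addr (n : nat) (u v : int) :
  n%:Z * u < n%:Z * v + n%:Z -> u <= v.
Proof. nia. Qed.

Section Alcove.
Variables (n k : nat) (Y : 'I_n -> int).
Hypotheses (kn : (0 < k < n)%N) (Yalc : alcove k Y).

Let n_gt0 : (0 < n)%N. Proof. by lia. Qed.

Lemma excess_incr z a :
  excess Y z (ordS a) - excess Y z a = n%:Z * incr k z a - incr (n * k) Y a.
Proof. by rewrite /excess /incr /twist PoszM; case: (a.+1 == n); ring. Qed.

(** Modulo [n] an excess is minus the value of [Y], whatever the heights, and the residues of [Y]
    are distinct. *)
Lemma excess_inj z z' a b c : excess Y z a = excess Y z' b + n%:Z * c -> a = b.
Proof.
rewrite /excess => eE; apply: (proj2 Yalc).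
have -> : Y a = (z a - z' b - c) * n%:Z + Y b by lia.
by rewrite modzMDl.
Qed.

Lemma excess_surj z r : exists a c, excess Y z a = r + n%:Z * c.
Proof.
have n0 : n%:Z != 0 by lia.
have lt_mod a : (absz (Y a %% n%:Z)%Z < n)%N.
  by have := modz_ge0 (Y a) n0; have := ltz_mod (Y a) n0; lia.
pose f a := Ordinal (lt_mod a).
have f_inj : injective f.
  move=> a b /(congr1 val) /= eab; apply: (proj2 Yalc).
  by have := modz_ge0 (Y a) n0; have := modz_ge0 (Y b) n0; lia.
have lt_r : (absz (- r %% n%:Z)%Z < n)%N.
  by have := modz_ge0 (- r) n0; have := ltz_mod (- r) n0; lia.
have /codomP[a /(congr1 val) /= ea] := inj_card_onto f_inj (leqnn _) (Ordinal lt_r).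
exists a, (z a - (Y a %/ n%:Z)%Z + (- r %/ n%:Z)%Z); rewrite /excess.
have := divz_eq (Y a) n%:Z; have := divz_eq (- r) n%:Z.
by have := modz_ge0 (Y a) n0; have := modz_ge0 (- r) n0; lia.
Qed.

Lemma profile_floor c : profile k (fun b => ((Y b + c) %/ n%:Z)%Z).
Proof.
move=> a; have := divz_bounds (Y a + c) n_gt0.
have := divz_bounds (Y (ordS a) + c) n_gt0; have := proj1 Yalc a.
rewrite /incr /twist PoszM; case: (a.+1 == n); nia.
Qed.

(** Rounding [Y + c] down to multiples of [n] leaves remainders in a window of length [n], so the
    result is a vertex. The choice of [c] selects the vertex, while [c'] only normalizes the
    heights. *)
Lemma simplex_floor c c' : exists2 V : ksub n k, V \in simplex k Y &
  represents (fun b => ((Y b + c) %/ n%:Z)%Z + c') V.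
Proof.
have [V zV] := profile_represents n_gt0 (profile_floor c).
exists V; last exact: represents_addr.
apply/(mem_simplex _ zV) => a b; rewrite /excess.
by have := divz_bounds (Y a + c) n_gt0; have := divz_bounds (Y b + c) n_gt0; lia.
Qed.

(** * Minors increase when extreme excesses are moved inwards *)

Section Levels.
Variables (R : realType) (A : 'M[R]_(k, n)) (M : R).
Hypotheses (A_gt0 : forall I, 0 < Delta A I) (A_le : forall I, Delta A I <= M).
Hypothesis A_simplex : forall I, I \in simplex k Y -> Delta A I = M.

(** Let [y] represent the vertex [V] of largest excess at [a], one height above [z] there and at
    most [z] elsewhere. The maximum of [z] and [y] is [raise a z], and raising their minimum [X] at
    [a] gives [V]. The exchange inequality compares V W with X W', and the minor of [V] is the
    largest. *)
Lemma Delta_raise_min z (W : ksub n k) a b : represents z W ->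
  (forall c, excess Y z a <= excess Y z c) ->
  excess Y z a + n%:Z < excess Y z b ->
  exists2 W' : ksub n k, represents (raise a z) W' & Delta A W < Delta A W'.
Proof.
move=> zW a_min ltab.
have [V VY Vz] := simplex_floor (- Y a) (z a + 1).
set y := (fun b => _) in Vz.
have eyE c : excess Y y c <= excess Y y a by
  rewrite /excess /y subrr div0z; have := divz_bounds (Y c - Y a) n_gt0; lia.
have eyL c : excess Y y a < excess Y y c + n%:Z by
  rewrite /excess /y subrr div0z; have := divz_bounds (Y c - Y a) n_gt0; lia.
have ya : y a = z a + 1 by rewrite /y subrr div0z add0r.
have y_le c : c != a -> y c <= z c.
  move=> ca; apply: (@mulz_lt_addr n).
  have neq : excess Y z c <> excess Y z a.
    by move=> e; case/eqP: ca; apply: (@excess_inj z z c a 0); rewrite e; lia.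
  have := eyE c; have := a_min c; rewrite /excess in neq *; rewrite ya; lia.
have zP := represents_profile zW; have yP := represents_profile Vz.
have [X Xx] := profile_represents n_gt0 (profile_min zP yP).
have [W' W'z] := profile_represents n_gt0 (profile_max zP yP).
have eW' : represents (raise a z) W'.
  apply: represents_ext W'z => c; rewrite /raise.
  by have [->|/y_le] := eqVneq c a; lia.
exists W' => //.
have VX : represents (raise a (fun c => Num.min (z c) (y c))) V.
  apply: represents_ext Vz => c; rewrite /raise.
  by have [->|/y_le] := eqVneq c a; lia.
have ltyb : y b < z b.
  suff : n%:Z * y b < n%:Z * z b by rewrite ltr_pM2l //; lia.
  by have := eyE b; move: ltab; rewrite /excess ya; lia.
have : Delta A V * Delta A W < Delta A X * Delta A W'.
  apply: (Delta_exchange_lt A_gt0 (a := a) (c := b) kn _ _ _ Xx VX zW eW') => [c||]; lia.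
rewrite (A_simplex VY) => lt1.
have M_gt0 : 0 < M by rewrite -(A_simplex VY).
have : Delta A X * Delta A W' <= M * Delta A W' by rewrite ler_pM2r.
by move=> /(lt_le_trans lt1); rewrite ltr_pM2l.
Qed.

Lemma Delta_lower_max z (W : ksub n k) a b : represents z W ->
  (forall c, excess Y z c <= excess Y z a) ->
  excess Y z b + n%:Z < excess Y z a ->
  exists z' (W' : ksub n k), [/\ raise a z' =1 z, represents z' W' &
    Delta A W < Delta A W'].
Proof.
move=> zW a_max ltab.
(* The offset is one less than in the raising case, so that the excess of the vertex is least at
   [a], one height below [z]. *)
have [V VY Vy] := simplex_floor (- Y a - 1) (z a).
set y := (fun b => _) in Vy.
have ya : y a = z a - 1.
  by rewrite /y; have := divz_bounds (Y a + (- Y a - 1)) n_gt0; nia.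
have eyE c : excess Y y a <= excess Y y c < excess Y y a + n%:Z.
  rewrite /excess ya /y; have := divz_bounds (Y c + (- Y a - 1)) n_gt0; lia.
have y_ge c : c != a -> z c <= y c.
  move=> ca; apply: (@mulz_lt_addr n).
  have neq : excess Y z c <> excess Y z a.
    by move=> e; case/eqP: ca; apply: (@excess_inj z z c a 0); rewrite e; lia.
  have := eyE c; have := a_max c; rewrite /excess in neq *; rewrite ya; lia.
have zP := represents_profile zW; have yP := represents_profile Vy.
have [W' W'x] := profile_represents n_gt0 (profile_min zP yP).
have [X Xx] := profile_represents n_gt0 (profile_max zP yP).
set x := (fun c => _) in W'x.
have exz : raise a x =1 z.
  by move=> c; rewrite /raise /x; have [->|/y_ge] := eqVneq c a; lia.
exists x, W'; split => //.
have eX : represents (raise a y) X.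
  apply: represents_ext Xx => c; rewrite /raise.
  by have [->|/y_ge] := eqVneq c a; lia.
have eW : represents (raise a x) W by apply: represents_ext zW => c; rewrite exz.
have ltyb : z b < y b.
  suff : n%:Z * z b < n%:Z * y b by rewrite ltr_pM2l //; lia.
  by have := eyE b; move: ltab; rewrite /excess ya; lia.
have : Delta A W * Delta A V < Delta A W' * Delta A X.
  by apply: (Delta_exchange_lt A_gt0 (a := a) (c := b) kn _ _ _ W'x eW Vy eX) => [c||];
     rewrite /x; lia.
rewrite (A_simplex VY) => lt1.
have M_gt0 : 0 < M by rewrite -(A_simplex VY).
have : Delta A W' * Delta A X <= Delta A W' * M by rewrite ler_pM2l.
by move=> /(lt_le_trans lt1); rewrite ltr_pM2r.
Qed.

End Levels.
End Alcove.

(** * Sortedness in terms of heights *)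

Lemma count_below_inj n (S T : {set 'I_n}) :
  (forall a, count_below S a = count_below T a) -> S = T.
Proof.
move=> eST; apply/setP => x; have := eST x.+1; rewrite !count_belowS eST.
by move/addIn; do 2!case: (x \in _).
Qed.

Lemma count_below_enum n (S : {set 'I_n}) a :
  count (fun x : 'I_n => (x < a)%N) (enum S) = count_below S a.
Proof.
rewrite -sum1_count big_enum_cond sum1dep_card.
by apply: eq_card => x; rewrite !inE.
Qed.

Section Sorting.
Variables (n k : nat) (I J : ksub n k).
Let L := merged (val I) (val J).
Let c a := (count_below (val I) a + count_below (val J) a)%N.

Lemma size_merged : size L = k.*2.
Proof.
rewrite /L /merged size_sort size_cat -!cardE.
by have /eqP-> := valP I; have /eqP-> := valP J; rewrite addnn.
Qed.

Lemma count_merged a : count (fun x : 'I_n => (x < a)%N) L = c a.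
Proof.
have /seq.permP-> : perm_eq L (enum (val I) ++ enum (val J)) by rewrite perm_sort.
by rewrite count_cat !count_below_enum.
Qed.

Lemma c_le a : (c a <= k.*2)%N.
Proof. by rewrite -count_merged -size_merged count_size. Qed.

Lemma nth_merged_lt (x0 : 'I_n) i a : (i < k.*2)%N -> (nth x0 L i < a)%N = (i < c a)%N.
Proof.
rewrite -count_merged -size_merged.
have : sorted (fun x y : 'I_n => (x <= y)%N) L.
  by apply: sort_sorted => x y; apply: leq_total.
elim: L i => //= x s IHs i xs i_lt.
case: (ltnP x a) => /= [ltxa|le_ax].
  by case: i i_lt => [|i] i_lt //=; rewrite (IHs _ (path_sorted xs)).
have := order_path_min (fun _ _ _ => @leq_trans _ _ _) xs => /allP min_x.
have /eqP -> : count (fun y : 'I_n => (y < a)%N) s == 0%N.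
  rewrite -leqn0 leqNgt -has_count; apply/hasPn => y /min_x xy.
  by rewrite -leqNgt (leq_trans le_ax).
apply/negbTE; rewrite -leqNgt; case: i i_lt => //= i i_lt.
by apply/(leq_trans le_ax)/min_x/mem_nth.
Qed.

(** An element occurs at most twice in the merged list, so positions at least two apart carry
    distinct entries, and [S] can be counted by positions. *)
Lemma count_below_onth (f : nat -> nat) (S : {set 'I_n}) a :
  (forall i j, (i < j)%N -> (f i + 2 <= f j)%N) -> (forall i : 'I_k, (f i < k.*2)%N) ->
  S = [set x | [exists m : 'I_k, onth L (f m) == Some x]] ->
  count_below S a = #|[set i : 'I_k | (f i < c a)%N]|.
Proof.
move=> f2 f_lt eS; case: (posnP k) => [k0|k_gt0].
  have no_ord (i : 'I_k) : False by have := ltn_ord i; rewrite {2}k0.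
  rewrite [RHS]eq_card0 => [|i]; last by case: (no_ord i).
  apply: eq_card0 => x; rewrite eS !inE; apply/negbTE/nandP; left.
  by apply/existsP => -[i]; case: (no_ord i).
have x0 : 'I_n by move: (f_lt (Ordinal k_gt0)); rewrite -size_merged; case: L.
have onth_eq (i : 'I_k) x : (onth L (f i) == Some x) = (x == nth x0 L (f i)).
  rewrite onthE (nth_map x0) ?size_merged //.
  by apply/eqP/eqP => [[]|->].
have g_inj : injective (fun i : 'I_k => nth x0 L (f i)).
  have lt_inj (i j : 'I_k) : (i < j)%N -> nth x0 L (f i) = nth x0 L (f j) -> False.
    move=> ij eij; set x := nth x0 L (f i) in eij.
    have := nth_merged_lt x0 x (f_lt i); rewrite -/x ltnn => /esym/negbT.
    have := nth_merged_lt x0 x.+1 (f_lt j); rewrite -eij ltnSn => /esym.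
    have := f2 _ _ ij; rewrite /c !count_belowS; do 2!case: (_ \in _); lia.
  move=> i j eij; have [/lt_inj/(_ eij)//|/lt_inj/(_ (esym eij))//|] := ltngtP i j.
  exact: val_inj.
rewrite -(card_imset _ g_inj); apply: eq_card => x; rewrite eS !inE.
apply/andP/imsetP => [[/existsP[i]]|[i]].
  by rewrite onth_eq => /eqP->; rewrite nth_merged_lt // => ilt; exists i; rewrite ?inE.
rewrite inE -(nth_merged_lt x0) // => lt_a ->; split => //.
by apply/existsP; exists i; rewrite onth_eq.
Qed.

Lemma card_ord_lt m : (m <= k)%N -> #|[set i : 'I_k | (i < m)%N]| = m.
Proof.
move=> mk; rewrite -sum1dep_card -(big_ord_widen k (fun=> 1%N)) //.
by rewrite sum1_card card_ord.
Qed.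

Lemma count_below_Sort1 a : count_below (Sort1 I J) a = uphalf (c a).
Proof.
rewrite (@count_below_onth (fun m => m.*2)) //; try by move=> *; lia.
  rewrite -[RHS]card_ord_lt; last by have := c_le a; lia.
  by apply: eq_card => i; rewrite !inE; lia.
by move=> i; have := ltn_ord i; lia.
Qed.

Lemma count_below_Sort2 a : count_below (Sort2 I J) a = (c a)./2.
Proof.
rewrite (@count_below_onth (fun m => m.*2.+1)) //; try by move=> *; lia.
  rewrite -[RHS]card_ord_lt; last by have := c_le a; lia.
  by apply: eq_card => i; rewrite !inE; lia.
by move=> i; have := ltn_ord i; lia.
Qed.

(** The heights of [Sort1] and [Sort2] are the upper and lower halves of the sum of the heights. So
    the pair is sorted iff one height exceeds the other by 0 or 1 throughout; since both vanish at
    index 0, only the spread of the difference matters. *)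
Lemma sorted_pairP : reflect
  (forall a b, height I a - height J a <= height I b - height J b + 1)
  (sorted_pair I J).
Proof.
have heightE (K : ksub n k) a : height K a = (count_below (val K) a)%:Z by [].
apply: (iffP eqP) => [eIJ a b|H].
  have cS (K : ksub n k) : val K \in [set val I; val J] ->
      (forall a, count_below (val K) a = uphalf (c a)) \/
      (forall a, count_below (val K) a = (c a)./2).
    rewrite eIJ => /set2P[] ->; [left; exact: count_below_Sort1|right; exact: count_below_Sort2].
  have cI d : c d = (count_below (val I) d + count_below (val J) d)%N by [].
  have [cIa|cIa] := cS I (set21 _ _); have [cJa|cJa] := cS J (set22 _ _);
    rewrite !heightE; have := cI a; have := cI b;
    rewrite !cIa !cJa; lia.
have near :
    (forall a, (count_below (val J) a <= count_below (val I) a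
      <= (count_below (val J) a).+1)%N) \/
    (forall a, (count_below (val I) a <= count_below (val J) a
      <= (count_below (val I) a).+1)%N).
  have H' a b : (count_below (val I) a + count_below (val J) b <=
      count_below (val I) b + count_below (val J) a + 1)%N.
    have H0 d : (count_below (val I) d <= (count_below (val J) d).+1)%N /\
                (count_below (val J) d <= (count_below (val I) d).+1)%N.
      have [dn|nd] := ltnP d n; last by rewrite !count_below_top.
      have o0 : (0 < n)%N by apply: leq_ltn_trans dn.
      have := H (Ordinal dn) (Ordinal o0); have := H (Ordinal o0) (Ordinal dn).
      have z0 (K : ksub n k) : height K (Ordinal o0) = 0.
        by rewrite heightE count_below0.
      by rewrite !z0 !heightE /=; lia.
    have [an|na] := ltnP a n; have [bn|nb] := ltnP b n.
    - by have := H (Ordinal an) (Ordinal bn); rewrite !heightE /=; lia.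
    - by have := H0 a; rewrite !(count_below_top _ nb); lia.
    - by have := H0 b; rewrite !(count_below_top _ na); lia.
    - by rewrite !(count_below_top _ nb) !(count_below_top _ na); lia.
  have [le|/existsNP[b ltb]] :=
    pselect (forall a, (count_below (val J) a <= count_below (val I) a)%N).
    by left=> a; have := H' a n; have := le a; rewrite !(count_below_top _ (leqnn n)); lia.
  right=> a; have := H' a b; have := H' n a; rewrite !(count_below_top _ (leqnn n)); lia.
by case: near => near; [|rewrite setUC]; congr [set _; _];
   apply: count_below_inj => a; rewrite ?count_below_Sort1 ?count_below_Sort2 /c;
   have := near a; lia.
Qed.

End Sorting.

(** * Alcoves are the maximal sorted collections *)

Section Simplices.
Variables n k : nat.
Hypothesis kn : (0 < k < n)%N.

Let n_gt0 : (0 < n)%N. Proof. by lia. Qed.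

(** Labels the vertices of an alcove by ['I_n], through the place of the largest excess. *)
Lemma simplex_top Y (a : 'I_n) : alcove k Y -> exists V : ksub n k,
  [/\ V \in simplex k Y, represents (fun b => ((Y b - Y a) %/ n%:Z)%Z) V &
    forall z, represents z V -> forall b, excess Y z b <= excess Y z a].
Proof.
move=> Yalc; have [V VY Vz] := simplex_floor kn Yalc (- Y a) 0.
have {}Vz : represents (fun b => ((Y b - Y a) %/ n%:Z)%Z) V.
  by apply: represents_ext Vz => b; rewrite addr0.
exists V; split=> // z zV b.
have := represents_shift Vz zV a b; rewrite subrr div0z /excess.
by have := divz_bounds (Y b - Y a) n_gt0; nia.
Qed.

(** Excesses are known modulo [n] and lie in a window of length [n] ending at the top one, so the
    top label determines them up to a common shift. *)
Lemma simplex_top_unique Y (a : 'I_n) (V V' : ksub n k) z z' : alcove k Y ->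
  V \in simplex k Y -> V' \in simplex k Y -> represents z V -> represents z' V' ->
  (forall b, excess Y z b <= excess Y z a) ->
  (forall b, excess Y z' b <= excess Y z' a) -> V = V'.
Proof.
move=> Yalc VY V'Y zV z'V' a_top a_top'.
suff : represents z' V by move/represents_inj; apply.
apply: represents_ext (represents_addr (z' a - z a) zV) => b.
have := elimT (mem_simplex Y zV) VY a b; have := elimT (mem_simplex Y z'V') V'Y a b.
have := a_top b; have := a_top' b; rewrite /excess => le1 le2 lt1 lt2.
suff : z b - z a = z' b - z' a by lia.
by apply/le_anti/andP; split; apply: (@mulz_lt_addr n); lia.
Qed.

Lemma excess_top z Y : exists a : 'I_n, forall b, excess Y z b <= excess Y z a.
Proof.
pose a0 := Ordinal n_gt0.
case: (@Order.TotalTheory.arg_maxP _ _ _ a0 predT (excess Y z) isT) => a _ a_max.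
by exists a => b; apply: a_max.
Qed.

Lemma excess_bot z Y : exists a : 'I_n, forall b, excess Y z a <= excess Y z b.
Proof.
pose a0 := Ordinal n_gt0.
case: (@Order.TotalTheory.arg_minP _ _ _ a0 predT (excess Y z) isT) => a _ a_min.
by exists a => b; apply: a_min.
Qed.

Lemma card_simplex (Y : 'I_n -> int) : alcove k Y -> #|simplex k Y| = n.
Proof.
move=> Yalc.
have [V HV] := fin_all_exists (fun a => simplex_top a Yalc).
have V_inj : injective V.
  move=> a b eV; have [_ Va topa] := HV a; have [_ _ topb] := HV b.
  have eE : excess Y (fun c => ((Y c - Y a) %/ n%:Z)%Z) a =
            excess Y (fun c => ((Y c - Y a) %/ n%:Z)%Z) b.
    by apply/le_anti; rewrite topa // topb // -eV.
  by apply: (excess_inj kn Yalc (c := 0)); rewrite mulr0 addr0; exact: eE.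
rewrite -[RHS]card_ord -cardsT -(card_imset _ V_inj); apply: eq_card => W.
apply/idP/imsetP => [WY|[a _ ->]]; last by have [] := HV a.
have zW := height_represents W; have [a a_top] := excess_top (height W) Y.
have [VY Va topa] := HV a; exists a => //.
exact: simplex_top_unique Yalc WY VY zW Va a_top (topa _ Va).
Qed.

Lemma sorted_simplex (Y : 'I_n -> int) : alcove k Y -> sorted_collection (simplex k Y).
Proof.
move=> Yalc; apply/forallP => V; apply/implyP => VY.
apply/forallP => W; apply/implyP => WY; apply/sorted_pairP => a b.
have := elimT (mem_simplex Y (height_represents V)) VY a b.
have := elimT (mem_simplex Y (height_represents W)) WY b a.
by rewrite /excess => lt1 lt2; apply: (@mulz_lt_addr n); lia.
Qed.

(** Sortedness with the vertex of top label [a] bounds each excess of [W] by the one at [a] plus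
    [n], and equality is excluded modulo [n]. *)
Lemma max_sorted_simplex (Y : 'I_n -> int) : alcove k Y -> max_sorted (simplex k Y).
Proof.
move=> Yalc; apply/maxsetP; split; first exact: sorted_simplex.
move=> C C_sorted subC; apply/eqP; rewrite eqEsubset subC andbT.
apply/subsetP => W WC; have zW := height_represents W.
apply/(mem_simplex Y zW) => b a.
have [V [VY _ topa]] := simplex_top a Yalc.
have zV := height_represents V.
have /sorted_pairP/(_ b a) : sorted_pair W V.
  by move/forallP/(_ W): C_sorted; rewrite WC => /forallP/(_ V); rewrite (subsetP subC).
have := topa _ zV b; have := @excess_inj _ _ _ kn Yalc (height W) (height W) b a 1.
have [->|] := eqVneq b a; first by lia.
move=> /eqP ba inj le_ba le1.
have neq : excess Y (height W) b <> excess Y (height W) a + n%:Z * 1 by move/inj/ba.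
have : n%:Z * (height W b - height V b) <= n%:Z * (height W a - height V a + 1).
  by rewrite ler_wpM2l.
by move: neq le_ba; rewrite /excess; lia.
Qed.

(** A generic point near the barycenter of [C] lies in an alcove that has all of [C] among its
    vertices. *)
Lemma sorted_sub_simplex (C : {set ksub n k}) : C != set0 ->
  sorted_collection C -> exists2 Y, alcove k Y & C \subset simplex k Y.
Proof.
move=> C_neq0 C_sorted; pose r := #|C|.
have r_gt0 : (0 < r)%N by rewrite card_gt0.
pose Z (a : 'I_n) : int := \sum_(I in C) height I a.
(* [P] is a generic perturbation of the sum [Z] of the vertices, modulo [D]. *)
pose N : int := n%:Z * (2 * n%:Z * k%:Z + 1).
pose D : nat := (n * (2 * n * k + 1) * r + n * n)%N.
pose P (a : 'I_n) : int := N * Z a + (n * k)%N%:Z * (a : nat)%:Z + (a : nat)%:Z.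
have incrZ a : 0 <= Z (ordS a) + r%:Z * twist k a - Z a <= r%:Z.
  have -> : Z (ordS a) + r%:Z * twist k a - Z a = \sum_(I in C) incr k (height I) a.
    by rewrite /Z /incr !big_split /= sumrN sumr_const /r; ring.
  have le1 (I : ksub n k) : 0 <= incr k (height I) a <= 1.
    exact: represents_profile (height_represents I) a.
  rewrite sumr_ge0 => [|I _]; last by have := le1 I; lia.
  rewrite /r -sum1_card (big_morph Posz PoszD erefl); apply: ler_sum => I _.
  by have := le1 I; lia.
have nk_gt0 : (0 < n * k)%N by rewrite muln_gt0; lia.
have D_gt0 : (0 < D)%N by rewrite /D; nia.
have DE : D%:Z = N * r%:Z + n%:Z * n%:Z by rewrite /D /N; lia.
have N_gt0 : 0 < N by rewrite /N; nia.
(* The slope [n * k] of the perturbation makes increments positive where those of [Z] vanish; the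
   summand [n * n] of [D] absorbs it in the upper bound and at the wrap-around. *)
have incrP a : 0 < incr (D * k) P a < D%:Z.
  have := incrZ a; rewrite /incr /P /twist val_ordS.
  have lt_an := ltn_ord a.
  case: eqP => ea; last first.
    rewrite !mulr0 !addr0 => incrZa.
    have -> : N * Z (ordS a) + (n * k)%N%:Z * a.+1%:Z + a.+1%:Z -
      (N * Z a + (n * k)%N%:Z * a%:Z + a%:Z) = N * (Z (ordS a) - Z a) + (n * k)%N%:Z + 1 by lia.
    by rewrite DE; nia.
  move=> incrZa; rewrite PoszM DE.
  have -> : (a : nat)%:Z = n%:Z - 1 by lia.
  have -> : N * Z (ordS a) + (n * k)%N%:Z * 0 + 0 + (N * r%:Z + n%:Z * n%:Z) * k%:Z -
    (N * Z a + (n * k)%N%:Z * (n%:Z - 1) + (n%:Z - 1)) =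
    N * (Z (ordS a) + r%:Z * k%:Z - Z a) + (n * k)%N%:Z - n%:Z + 1 by rewrite PoszM; ring.
  by nia.
(* Modulo [n] all terms of [P] but the last vanish, and so does [D]; [s] is the resulting quotient
   by [n] of the difference of [a] and [b]. *)
have P_inj a b : (P a %% D%:Z)%Z = (P b %% D%:Z)%Z -> a = b.
  move=> eP; have := divz_eq (P a) D%:Z; have := divz_eq (P b) D%:Z; rewrite eP => eb ea.
  pose q := ((P a %/ D%:Z)%Z - (P b %/ D%:Z)%Z).
  pose s := q * ((2 * n%:Z * k%:Z + 1) * r%:Z + n%:Z) - k%:Z * ((a : nat)%:Z - (b : nat)%:Z)
    - (2 * n%:Z * k%:Z + 1) * (Z a - Z b).
  have e : (a : nat)%:Z - (b : nat)%:Z = n%:Z * s.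
    have : P a - P b = q * D%:Z by rewrite /q; lia.
    by rewrite DE /P /s /N PoszM; lia.
  have lt_an := ltn_ord a; have lt_bn := ltn_ord b.
  have s0 : s = 0 by move: s e lt_an lt_bn; clear; nia.
  by apply: val_inj => /=; move: e; rewrite s0; lia.
have P_C (I : ksub n k) a b : I \in C ->
    D%:Z * (height I a - height I b - 1) + P b < P a.
  move=> IC; set u := height I a - height I b.
  have ub : - k%:Z <= u <= k%:Z.
    by have := height_bounds I a; have := height_bounds I b; rewrite /u; lia.
  (* By sortedness each of the other [r - 1] subsets loses at most one against [I], and [I] itself
     loses nothing; this saves the unit that gives strictness. *)
  have : r%:Z * u <= r%:Z - 1 + (Z a - Z b).
    have -> : r%:Z * u = \sum_(J in C) u by rewrite sumr_const -mulr_natl natz.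
    rewrite -lerBlDr /Z -!sumrB (bigD1 I) //= subrr add0r.
    have -> : r%:Z - 1 = \sum_(J in C | J != I) 1.
      rewrite /r -sum1_card (bigD1 I) //= PoszD addrAC subrr add0r.
      by rewrite (big_morph Posz PoszD erefl).
    apply: ler_sum => J /andP[JC _].
    have /sorted_pairP/(_ a b) : sorted_pair I J.
      by move/forallP/(_ I): C_sorted; rewrite IC => /forallP/(_ J); rewrite JC.
    by rewrite /u; lia.
  have lt_an := ltn_ord a; have lt_bn := ltn_ord b.
  move=> le_u; have : N * (r%:Z * u) <= N * (r%:Z - 1 + (Z a - Z b)) by rewrite ler_pM2l.
  have : n%:Z * n%:Z * u <= n%:Z * n%:Z * k%:Z by rewrite ler_wpM2l //; lia.
  have : (n%:Z * k%:Z + 1) * ((b : nat)%:Z - (a : nat)%:Z) <= (n%:Z * k%:Z + 1) * (n%:Z - 1).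
    by rewrite ler_wpM2l //; lia.
  have kn' : k%:Z < n%:Z by lia.
  by rewrite DE /P PoszM /N; nia.
pose rho a := (P a %% D%:Z)%Z.
pose rank a := #|[set b | rho b < rho a]|.
have rank_lt a b : rho b < rho a -> (rank b < rank a)%N.
  move=> lt_ba; apply: proper_card; apply/properP; split.
    by apply/subsetP => c; rewrite !inE => /lt_trans; apply.
  by exists b; rewrite !inE ?ltxx.
have rank_n a : (rank a < n)%N.
  rewrite -[ltnRHS]card_ord -cardsT; apply: proper_card; apply/properP; split.
    exact: subsetT.
  by exists a; rewrite !inE ?ltxx.
(* The integer parts of [P / D] are kept and the fractional parts are replaced by their ranks, which
   preserves the strict comparisons of differences with integers. *)
pose Y a := n%:Z * (P a %/ D%:Z)%Z + (rank a)%:Z.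
have Y_mono a b u : D%:Z * u + P b < P a -> n%:Z * u + Y b < Y a.
  have := divz_eq (P a) D%:Z; have := divz_eq (P b) D%:Z; rewrite -/(rho a) -/(rho b).
  have D0 : D%:Z != 0 by lia.
  have := modz_ge0 (P a) D0; have := modz_ge0 (P b) D0.
  have := ltz_mod (P a) D0; have := ltz_mod (P b) D0; rewrite -/(rho a) -/(rho b) /Y.
  have := rank_n b; set qa := (P a %/ _)%Z; set qb := (P b %/ _)%Z.
  move=> rb lt_b lt_a ge_b ge_a eb ea lt_P.
  have le_q : u + qb <= qa by apply: (@mulz_lt_addr D); lia.
  have [eq_q|ne_q] := eqVneq (u + qb) qa.
    have eD : D%:Z * (u + qb) = D%:Z * qa by rewrite eq_q.
    have /rank_lt : rho b < rho a by lia.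
    by rewrite -eq_q; lia.
  have : n%:Z * (u + qb + 1) <= n%:Z * qa by rewrite ler_wpM2l //; lia.
  by lia.
have twistM (m : nat) (a : 'I_n) : twist (m * k) a = m%:Z * twist k a.
  by rewrite /twist PoszM; case: (_ == _); rewrite ?mulr0.
exists Y; last first.
  apply/subsetP => I IC; apply/(mem_simplex Y (height_represents I)) => a b.
  by have := Y_mono _ _ _ (P_C I a b IC); rewrite /excess; lia.
split=> [a|a b eY].
  have := incrP a; rewrite /incr !twistM => /andP[gt0 ltD].
  have := @Y_mono (ordS a) a (- twist k a); have := @Y_mono a (ordS a) (twist k a - 1).
  by lia.
have eqr : rank a = rank b.
  move: eY; rewrite /Y ![n%:Z * _]mulrC !modzMDl !modz_small; first by case.
  - by have := rank_n b; lia.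
  - by have := rank_n a; lia.
apply: P_inj; apply: le_anti; rewrite -/(rho a) -/(rho b) !leNgt.
by apply/andP; split; apply/negP => /rank_lt; rewrite eqr ltnn.
Qed.

End Simplices.

(** * Cubes of alcoves *)

Lemma Gamma_adj_sym n k (C D : {set ksub n k}) : Gamma_adj C D = Gamma_adj D C.
Proof. by rewrite /Gamma_adj setIC eq_sym; do 2!case: (max_sorted _). Qed.

Lemma mulz_small (n : nat) (u : int) : - n%:Z < n%:Z * u < n%:Z -> u = 0.
Proof. by move=> lt_n; apply/le_anti/andP; split; apply: (@mulz_lt_addr n); lia. Qed.

Lemma shift_le (x y : int) (s t : bool) : x < y -> x - s%:Z + t%:Z <= y.
Proof. by case: s; case: t; lia. Qed.

Lemma shift_ge (x y : int) (s t : bool) : y < x -> y <= x - s%:Z + t%:Z.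
Proof. by case: s; case: t; lia. Qed.

Section Moves.
Variables n k : nat.
Hypothesis kn : (0 < k < n)%N.

(* The vertex of [Y] that [Y'] loses is the one whose excess is largest at [a]. *)
Lemma Gamma_adj_swap (Y Y' : 'I_n -> int) (a b : 'I_n) j :
  alcove k Y -> alcove k Y' -> Y a = Y b + 1 + n%:Z * j ->
  (forall c, Y' c = Y c + (c == b)%:Z - (c == a)%:Z) ->
  Gamma_adj (simplex k Y) (simplex k Y').
Proof.
move=> Yalc Y'alc eab Y'E.
have [V [VY Vz topa]] := simplex_top kn a Yalc.
set z := (fun c => _) in Vz.
have ab : a != b by apply/eqP => eq_ab; have j0 := @mulz_small n j; move: eab; rewrite eq_ab; lia.
have zab : excess Y z a - excess Y z b = n%:Z - 1.
  have := topa _ Vz b; have := elimT (mem_simplex Y Vz) VY a b.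
  rewrite /excess => lt1 le1; have : 1 <= z a - z b - j <= 1.
    by apply/andP; split; apply: (@mulz_lt_addr n); lia.
  by move=> e1; have -> : z a = z b + j + 1; lia.
have VY' : V \notin simplex k Y'.
  apply/negP => /(mem_simplex Y' Vz)/(_ a b).
  by move: zab; rewrite /excess !Y'E !eqxx (eq_sym b a) (negbTE ab); lia.
have sub W : W \in simplex k Y -> W != V -> W \in simplex k Y'.
  move=> WY; apply: contraNT => WY'; apply/eqP.
  have zW := height_represents W; set w := height W in zW.
  have lt_n := elimT (mem_simplex Y zW) WY.
  apply: (simplex_top_unique kn Yalc WY VY zW Vz _ (topa _ Vz)) => c.
  have [//|ltac] := leP (excess Y w c) (excess Y w a).
  case/negP: WY'; apply/(mem_simplex Y' zW) => d d'.
  have ew : excess Y w b = excess Y w a + 1.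
    have := lt_n a b; have := lt_n b a; have := lt_n c b.
    move: ltac; rewrite /excess => ltac lt_cb lt_ba lt_ab.
    have : 0 <= w a - w b - j <= 1.
      by apply/andP; split; apply: (@mulz_lt_addr n); lia.
    have [e1|] := eqVneq (w a) (w b + j + 1); first by rewrite e1 in ltac lt_ab *; lia.
    by move=> ne1 e1; have -> : w a = w b + j; lia.
  (* As the excess at [b] is one above that at [a], passing to [Y'] merely exchanges the two, and
     the window condition persists. *)
  suff E' c' : excess Y' w c' = excess Y w (tperm a b c') by rewrite !E'.
  move: ew; rewrite /excess Y'E.
  case: tpermP => [->|->|/eqP/negbTE-> /eqP/negbTE->]; last by lia.
    by rewrite eqxx (negbTE ab); lia.
  by rewrite eqxx eq_sym (negbTE ab); lia.
have eqI : simplex k Y :&: simplex k Y' = simplex k Y :\ V.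
  apply/setP => W; rewrite in_setI in_setD1.
  have [->|neq_WV] := eqVneq W V; first by rewrite (negbTE VY') andbF.
  by rewrite /=; apply: andb_idr => /sub; apply.
apply/and4P; split; try exact: max_sorted_simplex.
  by apply: contraNneq VY' => <-.
have := cardsD1 V (simplex k Y); rewrite eqI VY card_simplex //.
by move: #|_| => m ->.
Qed.

(** In an alcove no two excesses differ by [n], so [n + 1] is the least gap that violates the vertex
    condition; crossing turns it into [n - 1]. *)
Definition bottoms (Y z : 'I_n -> int) (S : {set 'I_n}) : {set 'I_n} :=
  [set a | [exists b in S, excess Y z b == excess Y z a + n.+1%:Z]].

Definition tops (Y z : 'I_n -> int) : {set 'I_n} :=
  [set b | [exists a, excess Y z b == excess Y z a + n.+1%:Z]].

(* Crosses the walls that exchange a top label in [S] and its bottom partner,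
   which brings their excesses closer to each other. *)
Definition cross (Y z : 'I_n -> int) (S : {set 'I_n}) (c : 'I_n) : int :=
  Y c + (c \in S)%:Z - (c \in bottoms Y z S)%:Z.

Section Cross.
Variables (Y z : 'I_n -> int) (W : ksub n k).
Hypotheses (Yalc : alcove k Y) (zW : represents z W).
Hypothesis diam : forall a b, excess Y z a - excess Y z b < 2 * n%:Z.
Local Notation e := (excess Y z).

Lemma topsP b : reflect (exists a, e b = e a + n.+1%:Z) (b \in tops Y z).
Proof. by rewrite inE; apply: (iffP existsP) => -[a /eqP ea]; exists a => //; apply/eqP. Qed.

Lemma bottomsP (S : {set 'I_n}) a :
  reflect (exists2 b, b \in S & e b = e a + n.+1%:Z) (a \in bottoms Y z S).
Proof.
rewrite inE; apply: (iffP existsP) => [[b /andP[bS /eqP eb]]|[b bS eb]].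
  by exists b.
by exists b; rewrite bS; apply/eqP.
Qed.

Lemma e_inj a b j : e a = e b + n%:Z * j -> a = b.
Proof. by move/(excess_inj kn Yalc). Qed.

(** A label in both roles would produce a gap of [2 * n + 2], which [diam] excludes. *)
Lemma top_not_bottom (S : {set 'I_n}) a : a \in tops Y z -> a \notin bottoms Y z S.
Proof.
move=> /topsP[a' ea]; apply/negP => /bottomsP[b _ eb].
by have := diam b a'; lia.
Qed.

Lemma excess_cross (S : {set 'I_n}) c :
  excess (cross Y z S) z c = e c - (c \in S)%:Z + (c \in bottoms Y z S)%:Z.
Proof. by rewrite /excess /cross; ring. Qed.

Section Subset.
Variable S : {set 'I_n}.
Hypothesis S_tops : S \subset tops Y z.

Lemma cross_cases c :
  [\/ c \in S /\ c \notin bottoms Y z S, c \notin S /\ c \in bottoms Y z S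
    | c \notin S /\ c \notin bottoms Y z S].
Proof.
have [cS|cS] := boolP (c \in S); last first.
  by case: (boolP (c \in bottoms Y z S)) => cbot; [constructor 2|constructor 3].
by constructor 1; rewrite top_not_bottom // (subsetP S_tops).
Qed.

(** The excesses of partners have adjacent residues modulo [n], and crossing exchanges these
    residues. So they stay distinct, which also keeps increments away from 0 and [n]. *)
Lemma alcove_cross : alcove k (cross Y z S).
Proof.
have n0 : n%:Z != 0 by lia.
have partner c : c \in S -> exists2 a, a \in bottoms Y z S & e c = e a + n%:Z + 1.
  move=> cS; have /topsP[a ea] := subsetP S_tops _ cS.
  by exists a; [apply/bottomsP; exists c|lia].
have partner' c : c \in bottoms Y z S -> exists2 b, b \in S & e b = e c + n%:Z + 1.
  by move=> /bottomsP[b bS eb]; exists b => //; lia.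
have sep c d j : c \in S -> d \notin bottoms Y z S ->
    e c - 1 <> e d + n%:Z * j.
  move=> /partner[a abot ea] dbot ecd.
  by case/negP: dbot; rewrite -(@e_inj a d (j - 1)) //; lia.
have sep' c d j : c \in bottoms Y z S -> d \notin S ->
    e c + 1 <> e d + n%:Z * j.
  move=> /partner'[b bS eb] dS ecd.
  by case/negP: dS; rewrite -(@e_inj b d (j + 1)) //; lia.
have inj a b j : excess (cross Y z S) z a = excess (cross Y z S) z b + n%:Z * j -> a = b.
  rewrite !excess_cross.
  case: (cross_cases a) => -[aS abot]; case: (cross_cases b) => -[bS bbot];
  rewrite ?aS ?(negbTE aS) ?abot ?(negbTE abot) ?bS ?(negbTE bS) ?bbot ?(negbTE bbot) => eab.
  - by apply: (@e_inj a b j); lia.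
  - have [p pbot ep] := partner a aS; have [q qS eq] := partner' b bbot.
    have eqp : q = p by apply: (@e_inj q p (2 - j)); lia.
    by have := top_not_bottom S (subsetP S_tops _ qS); rewrite eqp pbot.
  - by case: (sep a b j aS bbot); lia.
  - have [p pbot ep] := partner b bS; have [q qS eq] := partner' a abot.
    have eqp : q = p by apply: (@e_inj q p (2 + j)); lia.
    by have := top_not_bottom S (subsetP S_tops _ qS); rewrite eqp pbot.
  - by apply: (@e_inj a b j); lia.
  - by case: (sep' a b j abot bS); lia.
  - by case: (sep b a (- j) bS abot); lia.
  - by case: (sep' b a (- j) bbot aS); lia.
  - by apply: (@e_inj a b j); lia.
split=> [a|a b eY]; last first.
  pose j := z a - z b - (cross Y z S a %/ n%:Z)%Z + (cross Y z S b %/ n%:Z)%Z.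
  apply: (inj a b j); rewrite /excess /j.
  have := divz_eq (cross Y z S a) n%:Z; have := divz_eq (cross Y z S b) n%:Z.
  by rewrite eY; lia.
have bounds := proj1 Yalc a; have x01 := represents_profile zW a.
have ediff := excess_incr k Y z a; have ediff' := excess_incr k (cross Y z S) z a.
have Sa : ordS a <> a.
  move=> Sa; move: ediff; rewrite Sa subrr => ediff.
  by have x0 : incr k z a = 0; [apply: (@mulz_small n); lia|rewrite x0 in ediff; lia].
have ne0 : incr (n * k) (cross Y z S) a <> 0.
  by move=> i0; apply: Sa; apply: (inj _ _ (incr k z a)); lia.
have nen : incr (n * k) (cross Y z S) a <> n%:Z.
  by move=> i0; apply: Sa; apply: (inj _ _ (incr k z a - 1)); lia.
move: ediff'; rewrite !excess_cross.
case: (cross_cases a) => -[aS abot]; case: (cross_cases (ordS a)) => -[bS bbot];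
  rewrite ?aS ?(negbTE aS) ?abot ?(negbTE abot) ?bS ?(negbTE bS) ?bbot ?(negbTE bbot); try lia.
(* A top next to a bottom changes the increment by 2. Leaving the range would make these two labels
   partners, which an increment of [z] in 0, 1 excludes. *)
- have [p _ ep] := partner a aS => ediff'.
  suff : incr (n * k) Y a <> 1 by lia.
  move=> i1; have ep' : e p = e (ordS a) + n%:Z * (- incr k z a - 1) by lia.
  have epa := e_inj ep'; rewrite epa in ep'.
  by have := mulz_small (n := n) (u := - incr k z a - 1); lia.
- have [p _ ep] := partner (ordS a) bS => ediff'.
  suff : incr (n * k) Y a <> n%:Z - 1 by lia.
  move=> i1; have ep' : e p = e a + n%:Z * (incr k z a - 2) by lia.
  have epa := e_inj ep'; rewrite epa in ep'.
  by have := mulz_small (n := n) (u := incr k z a - 2); lia.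
Qed.

(** A gap grows only if its upper end is a bottom or its lower end a top; then the partner, [n + 1]
    further out, shows that there was room. *)
Lemma diam_cross a b :
  excess (cross Y z S) z a - excess (cross Y z S) z b < 2 * n%:Z.
Proof.
rewrite !excess_cross; have lt_ab := diam a b.
case: (cross_cases a) => -[aS abot]; case: (cross_cases b) => -[bS bbot];
  rewrite ?aS ?(negbTE aS) ?abot ?(negbTE abot) ?bS ?(negbTE bS) ?bbot ?(negbTE bbot);
  try lia.
- have /bottomsP[t _ et] := abot; have /topsP[p ep] := subsetP S_tops _ bS.
  by have := diam t p; lia.
- by have /bottomsP[t _ et] := abot; have := diam t b; lia.
- by have /topsP[p ep] := subsetP S_tops _ bS; have := diam a p; lia.
Qed.

End Subset.

Lemma bottoms_disjoint (S : {set 'I_n}) a b : S \subset tops Y z ->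
  b \notin S -> e b = e a + n.+1%:Z -> a \notin bottoms Y z S.
Proof.
move=> ST bS eb; apply/negP => /bottomsP[b' b'S eb'].
by case/negP: bS; rewrite -(@e_inj b' b 0) //; lia.
Qed.

Lemma Gamma_adj_cross (S : {set 'I_n}) b : S \subset tops Y z ->
  b \in tops Y z -> b \notin S ->
  Gamma_adj (simplex k (cross Y z S)) (simplex k (cross Y z (b |: S))).
Proof.
move=> ST bT bS; have /topsP[a eb] := bT.
have bST : b |: S \subset tops Y z by rewrite subUset sub1set bT.
have aS : a \notin S.
  apply/negP => aS; have /negP[] := top_not_bottom (b |: S) (subsetP ST a aS).
  by apply/bottomsP; exists b; rewrite ?setU11.
have abot := bottoms_disjoint ST bS eb.
have bbot := top_not_bottom S bT.
apply: (@Gamma_adj_swap _ _ a b (z a - z b + 1)) => [||| c]; try exact: alcove_cross.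
  rewrite /cross (negbTE aS) (negbTE abot) (negbTE bS) (negbTE bbot).
  by move: eb; rewrite /excess; lia.
rewrite /cross in_setU1.
have -> : (c \in bottoms Y z (b |: S)) = (c \in bottoms Y z S) || (c == a).
  apply/bottomsP/orP => [[t]|[/bottomsP[t tS et]|/eqP->]].
  - rewrite in_setU1 => /orP[/eqP->|tS] et; [right|left].
      by apply/eqP/(@e_inj c a 0); lia.
    by apply/bottomsP; exists t.
  - by exists t; rewrite // in_setU1 tS orbT.
  - by exists b; rewrite ?setU11.
have [->|_] := eqVneq c a; first
  by rewrite (negbTE abot) (negbTE aS) orbF orFb; case: (a == b); ring.
have [->|_] := eqVneq c b; first by rewrite (negbTE bS) (negbTE bbot) /=; ring.
by rewrite orFb orbF; case: (_ \in S); case: (_ \in _); ring.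
Qed.

(** For a top [b] with partner [a], the vertex of [Y] with largest excess at [a] has its least
    excess at [b]. Crossing this pair widens its window beyond [n], while crossing other pairs keeps
    it a vertex, so it detects whether [b] is in [S]. *)
Lemma simplex_cross_inj (S S' : {set 'I_n}) :
  S \subset tops Y z -> S' \subset tops Y z ->
  simplex k (cross Y z S) = simplex k (cross Y z S') -> S = S'.
Proof.
move=> ST S'T eSS'; suff vertex b : b \in tops Y z ->
    exists V, forall S : {set 'I_n}, S \subset tops Y z ->
      (V \in simplex k (cross Y z S)) = (b \notin S).
  apply/setP => b; have [bT|bT] := boolP (b \in tops Y z); last first.
    by rewrite !(contraNF (subsetP _ b) bT).
  have [V VS] := vertex b bT.
  by apply: negb_inj; rewrite -(VS S ST) -(VS S' S'T) eSS'.
move=> {eSS'} /topsP[a eb]; have bT : b \in tops Y z by apply/topsP; exists a.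
have [V [VY Vu topa]] := simplex_top kn a Yalc; exists V => {}S {}ST.
set u := (fun c => _) in Vu.
have uab : excess Y u b = excess Y u a - n%:Z + 1.
  have := topa _ Vu b; have := elimT (mem_simplex Y Vu) VY a b.
  move: eb; rewrite /excess => eb lt1 le1.
  have : 1 <= u a - u b + z b - z a - 1 <= 1.
    by apply/andP; split; apply: (@mulz_lt_addr n); lia.
  by move=> e1; have -> : u b = u a + z b - z a - 2; lia.
have aS : a \notin S.
  apply/negP => aS; have /negP[] := top_not_bottom (tops Y z) (subsetP ST a aS).
  by apply/bottomsP; exists b.
have bbot := top_not_bottom S bT.
have excessE c : excess (cross Y z S) u c =
    excess Y u c - (c \in S)%:Z + (c \in bottoms Y z S)%:Z.
  by rewrite /excess /cross; ring.
apply/(mem_simplex _ Vu)/idP => [H|bS c d].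
  apply/negP => bS; have := H a b; rewrite !excessE (negbTE aS) bS (negbTE bbot).
  have -> : a \in bottoms Y z S by apply/bottomsP; exists b.
  by rewrite uab; lia.
have abot := bottoms_disjoint ST bS eb.
have ub c' : excess (cross Y z S) u c' <= excess Y u a.
  rewrite excessE; have [->|ca] := eqVneq c' a.
    by rewrite (negbTE aS) (negbTE abot); lia.
  have : excess Y u c' <> excess Y u a.
    by move=> eu; case/eqP: ca; apply: (@excess_inj _ _ _ kn Yalc u u _ _ 0); lia.
  by move=> /eqP ne; apply: shift_le; rewrite lt_neqAle ne topa.
have lb c' : excess Y u b <= excess (cross Y z S) u c'.
  rewrite excessE; have [->|cb] := eqVneq c' b.
    by rewrite (negbTE bS) (negbTE bbot); lia.
  have : excess Y u c' <> excess Y u b.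
    by move=> eu; case/eqP: cb; apply: (@excess_inj _ _ _ kn Yalc u u _ _ 0); lia.
  move=> /eqP ne; apply: shift_ge; rewrite lt_neqAle eq_sym ne /=.
  by have := elimT (mem_simplex Y Vu) VY a c'; rewrite uab; lia.
by have := ub c; have := lb d; lia.
Qed.

Lemma simplex_ext (Y1 Y2 : 'I_n -> int) : Y1 =1 Y2 -> simplex k Y1 = simplex k Y2.
Proof.
move=> eY; apply/setP => V; rewrite !inE; apply: eq_forallb => a; apply: eq_forallb => b.
by rewrite /excess !eY.
Qed.

Lemma cross0 : cross Y z set0 =1 Y.
Proof.
move=> c; rewrite /cross inE (_ : (c \in bottoms _ _ _) = false); first by lia.
by apply/bottomsP => -[b]; rewrite inE.
Qed.

(** The subsets of [tops Y z] are the corners of a cube; [Y] and the full crossing are opposite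
    corners. *)
Lemma on_common_cube_cross : tops Y z != set0 ->
  on_common_cube (simplex k Y) (simplex k (cross Y z (tops Y z))).
Proof.
set T := tops Y z => T_neq0.
pose sel (x : {ffun 'I_#|T| -> bool}) := [set enum_val i | i in [set i | x i]].
have in_sel x i : (enum_val i \in sel x) = x i.
  by rewrite mem_imset ?inE //; apply: enum_val_inj.
have selT x : sel x \subset T.
  by apply/subsetP => _ /imsetP[i _ ->]; apply: enum_valP.
exists #|T|, (fun x => simplex k (cross Y z (sel x))); split; last first.
  exists [ffun=> false], [ffun=> true]; split.
    rewrite (_ : sel _ = set0); first exact/simplex_ext/cross0.
    by apply/setP => b; rewrite inE; apply/negbTE/imsetP => -[i]; rewrite inE ffunE.
  congr (simplex k (cross Y z _)); apply/setP => b.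
  apply/idP/idP => [|bT]; first exact: (subsetP (selT _)).
  by rewrite -(enum_rankK_in bT bT) in_sel ffunE.
split; first by rewrite card_gt0.
  move=> x y /(simplex_cross_inj (selT x) (selT y)) exy.
  by apply/ffunP => i; rewrite -!in_sel exy.
have adj (x y : {ffun 'I_#|T| -> bool}) i :
    x i = false -> y i = true -> (forall j, j != i -> x j = y j) ->
    Gamma_adj (simplex k (cross Y z (sel x))) (simplex k (cross Y z (sel y))).
  move=> xi yi exy; have -> : sel y = enum_val i |: sel x.
    apply/setP => b; rewrite in_setU1; apply/imsetP/orP => [[j]|].
      rewrite inE => yj ->; have [->|ji] := eqVneq j i; first by left.
      by right; rewrite in_sel exy.
    case=> [/eqP->|/imsetP[j]]; first by exists i; rewrite ?inE.
    rewrite inE => xj ->; exists j => //; rewrite inE -exy //.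
    by apply: contraTneq xj => ->; rewrite xi.
  apply: Gamma_adj_cross => //; first exact: enum_valP.
  by rewrite in_sel xi.
move=> x y /cards1P[i exy].
have neq j : (x j != y j) = (j == i) by have /setP/(_ j) := exy; rewrite !inE.
have eq j : j != i -> x j = y j by rewrite -neq negbK => /eqP.
have := neq i; rewrite eqxx; case xi: (x i); case yi: (y i) => // _.
  by rewrite Gamma_adj_sym; apply: (adj y x i) => // j /eq.
exact: (adj x y i).
Qed.

Definition below (Y' : 'I_n -> int) b : {set 'I_n} :=
  [set a | excess Y' z a + n%:Z < excess Y' z b].
Definition above (Y' : 'I_n -> int) b : {set 'I_n} :=
  [set c | excess Y' z b < excess Y' z c].

(** If [b] is a top, its partner leaves the labels below it. If [b] is a bottom, [diam] is violated.
    Otherwise the label [y] with excess one less than that of [b] had at least as large a count, and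
    [b] itself above it in addition. *)
Lemma below_above_cross (Y' := cross Y z (tops Y z)) b : below Y' b != set0 ->
  exists2 b', below Y b' != set0 &
    (#|below Y' b| + #|above Y' b| < #|below Y b'| + #|above Y b'|)%N.
Proof.
have TT := subxx (tops Y z).
have eE := excess_cross (tops Y z); have cases := cross_cases TT.
rewrite -/Y' in eE.
have eEge a : excess Y' z a < e a -> a \in tops Y z.
  by rewrite eE; case: (a \in tops _ _) => //; case: (_ \in _); lia.
move=> /set0Pn[a0]; rewrite inE => a0b.
have e_le a : excess Y' z a + n%:Z < excess Y' z b -> e a <= excess Y' z a.
  move=> ltab; rewrite leNgt; apply/negP => /[dup] lt_a /eEge aT.
  have /topsP[p ep] := aT; have := diam b p.
  move: ltab; rewrite !eE.
  case: (cases b) => -[bT bbot]; rewrite aT (negbTE (top_not_bottom _ aT))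
    ?bT ?(negbTE bT) ?bbot ?(negbTE bbot);
    lia.
case: (cases b) => -[bT bbot].
- have e'b : excess Y' z b = e b - 1 by rewrite eE bT (negbTE bbot); lia.
  have /topsP[p ep] := bT.
  have pb : p \in below Y b by rewrite inE; lia.
  exists b; first by apply/set0Pn; exists p.
  have sub_below : below Y' b \subset below Y b :\ p.
    apply/subsetP => a; rewrite !inE => lt_a; have := e_le a lt_a; rewrite e'b in lt_a.
    move=> le_a; rewrite (_ : e a + _ < _) ?andbT; last by lia.
    apply: contraTneq lt_a => ->; rewrite eE.
    have -> : p \in bottoms Y z (tops Y z) by apply/bottomsP; exists b.
    by have := top_not_bottom (tops Y z); case: (p \in tops Y z); lia.
  have sub_above : above Y' b \subset above Y b.
    apply/subsetP => c; rewrite !inE e'b eE.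
    case: (cases c) => -[cT cbot]; rewrite ?cT ?(negbTE cT) ?cbot ?(negbTE cbot); try lia.
      by have /bottomsP[t _ et] := cbot; have := diam t p; lia.
    move=> lt_c; suff : e c <> e b by lia.
    by move=> ec; case/negP: cT; rewrite (@e_inj c b 0) //; lia.
  rewrite (cardsD1 p (below Y b)) pb -[nat_of_bool true]/1%N add1n addSn ltnS.
  by rewrite leq_add ?subset_leq_card.
- have /bottomsP[t _ et] := bbot; have := e_le a0 a0b; have := diam t a0.
  by move: a0b; rewrite [excess Y' z b]eE (negbTE bT) bbot; lia.
have e'b : excess Y' z b = e b by rewrite eE (negbTE bT) (negbTE bbot); lia.
have [y [c ey]] := excess_surj kn Yalc z (e b - 1).
have ltab := e_le a0 a0b; rewrite e'b in a0b.
(* The value -1 would make [y] the bottom partner of [b]; all others but 0 contradict [diam]. *)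
have c0 : c = 0.
  have c1 : c <> -1 by move=> c1; case/negP: bT; apply/topsP; exists y; rewrite ey c1; lia.
  have := diam y a0; have := diam b y; rewrite ey => lt1 lt2.
  have : -1 <= c by apply: (@mulz_lt_addr n); lia.
  have : c <= 0 by apply: (@mulz_lt_addr n); lia.
  by lia.
rewrite c0 mulr0 addr0 in ey.
have sub_below : below Y' b \subset below Y y.
  apply/subsetP => a; rewrite !inE => lt_a; have := e_le a lt_a.
  rewrite e'b in lt_a; suff : e a + n%:Z <> e y by lia.
  by move=> ea; case/negP: bT; apply/topsP; exists a; lia.
have a0y : a0 \in below Y y by apply: (subsetP sub_below); rewrite inE e'b.
exists y; first by apply/set0Pn; exists a0.
have by_ : b \in above Y y by rewrite inE; lia.
have sub_above : above Y' b \subset above Y y :\ b.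
  apply/subsetP => d; rewrite !inE e'b => lt_d; apply/andP; split.
    by apply: contraTneq lt_d => ->; rewrite e'b ltxx.
  by move: lt_d; rewrite eE; case: (d \in _); case: (d \in _); lia.
rewrite (cardsD1 b (above Y y)) by_ -[nat_of_bool true]/1%N addnCA add1n ltnS.
by rewrite leq_add ?subset_leq_card.
Qed.

End Cross.
End Moves.

(** * Counting levels above a minor *)

Lemma cube_path_refl n k (C : {set ksub n k}) : max_sorted C -> cube_path 0 C C.
Proof. by move=> C_max; exists (fun _ => C); split. Qed.

Lemma cube_path_cons n k D (C1 C2 C3 : {set ksub n k}) : max_sorted C1 ->
  on_common_cube C1 C2 -> cube_path D C2 C3 -> cube_path D.+1 C1 C3.
Proof.
move=> C1_max C12 [c [c0 cD c_max c_cube]].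
exists (fun i => if i is i'.+1 then c i' else C1); split => //.
  by case=> // i /c_max.
by case=> [_|i /c_cube//]; rewrite c0.
Qed.

Lemma exists_cube_path n k (W : ksub n k) m Y z : (0 < k < n)%N ->
  alcove k Y -> represents z W ->
  (forall a b, excess Y z a - excess Y z b < 2 * n%:Z) ->
  (forall b, below z Y b != set0 -> (#|below z Y b| + #|above z Y b| <= m)%N) ->
  exists C D, [/\ (D <= m)%N, max_sorted C, W \in C & cube_path D (simplex k Y) C].
Proof.
move=> kn; elim: m Y => [|m IHm] Y Yalc zW diam bound;
  have Y_max := max_sorted_simplex kn Yalc;
  (have [WY|WY] := boolP (W \in simplex k Y);
    first by exists (simplex k Y), 0%N; split=> //; apply: cube_path_refl).
  case/negP: WY; apply/(mem_simplex Y zW) => b a; rewrite ltNge; apply/negP => le_ab.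
  have ne_ab : excess Y z b <> excess Y z a + n%:Z * 1.
    by move=> e_ab; have := excess_inj kn Yalc e_ab => eba; rewrite eba in le_ab; lia.
  have a_below : a \in below z Y b by rewrite inE; lia.
  have b_below : below z Y b != set0 by apply/set0Pn; exists a.
  by have := bound b b_below; rewrite (cardsD1 a) a_below.
have Talc := alcove_cross kn Yalc zW diam (subxx (tops Y z)).
have Tdiam := diam_cross kn diam (subxx (tops Y z)).
have Tbound b : below z (cross Y z (tops Y z)) b != set0 ->
    (#|below z (cross Y z (tops Y z)) b| + #|above z (cross Y z (tops Y z)) b| <= m)%N.
  move=> /(below_above_cross kn Yalc diam)[b' /bound le_m lt_b].
  by rewrite -ltnS (leq_trans lt_b).
have [C [D [le_Dm C_max WC path]]] := IHm _ Talc zW Tdiam Tbound.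
(* Without a wall to cross the alcove is unchanged, and the path found for [m] serves. *)
have [T0|T_neq0] := eqVneq (tops Y z) set0.
  exists C, D; split=> //; first exact: leqW.
  by move: path; rewrite T0 (simplex_ext k (cross0 kn Y z)).
exists C, D.+1; split=> //.
by apply: cube_path_cons path => //; exact: on_common_cube_cross zW diam _.
Qed.

(** Over one period both [n * height] and [Y] rise by [n * k], and a gap of exactly [n * k] is
    excluded modulo [n]. For [k = 2] this bounds the gaps by [2 * n]. *)
Lemma excess_height_lt n k (Y : 'I_n -> int) (W : ksub n k) a b :
  (0 < k < n)%N -> alcove k Y ->
  excess Y (height W) b - excess Y (height W) a < (n * k)%N%:Z.
Proof.
move=> kn Yalc; have [incrY _] := Yalc.
have Y_mono m (c d : 'I_n) : (d = c + m :> nat)%N -> Y c <= Y d.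
  elim: m d => [|m IHm] d ed; first by rewrite (_ : c = d) //; apply: ord_inj; rewrite ed addn0.
  have lt_m : (c + m < n)%N by have := ltn_ord d; lia.
  have := IHm (Ordinal lt_m) erefl; have := incrY (Ordinal lt_m).
  rewrite /incr /twist /= ifN; last by have := ltn_ord d; lia.
  rewrite (_ : ordS _ = d); first by lia.
  by apply: ord_inj; rewrite ed /= modn_small ?addnS //; have := ltn_ord d; lia.
have le_nk (c d : 'I_n) : Y d <= Y c + (n * k)%N%:Z.
  have n_gt0 : (0 < n)%N by lia.
  have last_lt : (n.-1 < n)%N by lia.
  pose o := Ordinal n_gt0; pose last := Ordinal last_lt.
  have lt_c := ltn_ord c; have lt_d := ltn_ord d.
  have := Y_mono c o c erefl; have := Y_mono (n.-1 - d)%N d last.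
  have := incrY last; rewrite /incr /twist /= prednK // eqxx.
  have -> : ordS last = o by apply: val_inj; rewrite /= prednK // modnn.
  by move=> ? /(_ ltac:(lia)); lia.
rewrite PoszM /excess; have [ab|ba] := leqP a b.
  have := Y_mono (b - a)%N a b; have := height_bounds W a; have := height_bounds W b.
  move=> hb ha /(_ ltac:(lia)) leY.
  have le : n%:Z * (height W b - height W a) <= n%:Z * k%:Z by rewrite ler_wpM2l //; lia.
  rewrite ltNge; apply/negP => ge.
  have eab : excess Y (height W) b = excess Y (height W) a + n%:Z * k%:Z.
    by rewrite /excess; lia.
  have eba := excess_inj kn Yalc eab; rewrite eba in ge.
  have : 0 < n%:Z * k%:Z by rewrite mulr_gt0; lia.
  by lia.
have := height_mono W (ltnW ba) => le_h; have := le_nk b a; rewrite PoszM => leY.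
have le : n%:Z * (height W b - height W a) <= 0 by rewrite pmulr_rle0; lia.
rewrite ltNge; apply/negP => ge.
have eab : excess Y (height W) b = excess Y (height W) a + n%:Z * k%:Z.
  by rewrite /excess; lia.
by have eba := excess_inj kn Yalc eab; rewrite eba ltnn in ba.
Qed.

Section LevelCount.
Variables (R : realType) (n k : nat) (A : 'M[R]_(k, n)) (Y : 'I_n -> int).
Variables (M : R) (lev : ksub n k -> nat) (l : nat).
Hypotheses (kn : (0 < k < n)%N) (Yalc : alcove k Y).
Hypotheses (A_gt0 : forall I, 0 < Delta A I) (A_le : forall I, Delta A I <= M).
Hypothesis A_simplex : forall I, I \in simplex k Y -> Delta A I = M.
Hypothesis lev_lt : forall I I', Delta A I < Delta A I' -> (lev I < lev I')%N.
Hypothesis lev_le : forall I, (lev I <= l)%N.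

Lemma raise_min_lev z (W : ksub n k) a b : represents z W ->
  (forall c, excess Y z a <= excess Y z c) ->
  excess Y z a + n%:Z < excess Y z b ->
  exists z' (W' : ksub n k), [/\ represents z' W', (lev W < lev W')%N &
    forall c, excess Y z' c = excess Y z c + n%:Z * (c == a)%:Z].
Proof.
move=> zW a_min lt_ab.
have [W' zW' /lev_lt lt_W] := Delta_raise_min kn Yalc A_gt0 A_le A_simplex zW a_min lt_ab.
by exists (raise a z), W'; split=> // c; rewrite /excess /raise; ring.
Qed.

Lemma lower_max_lev z (W : ksub n k) a b : represents z W ->
  (forall c, excess Y z c <= excess Y z a) ->
  excess Y z b + n%:Z < excess Y z a ->
  exists z' (W' : ksub n k), [/\ represents z' W', (lev W < lev W')%N &
    forall c, excess Y z' c = excess Y z c - n%:Z * (c == a)%:Z].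
Proof.
move=> zW a_max lt_ab.
have [z' [W' [ez zW' /lev_lt lt_W]]] :=
  Delta_lower_max kn Yalc A_gt0 A_le A_simplex zW a_max lt_ab.
by exists z', W'; split=> // c; rewrite /excess -ez /raise; ring.
Qed.

(** Each extreme label moved inwards gains a level and costs at most one unit of the count for [b].
    The labels below are used first, but one is kept so that moves remain possible; then those above
    are used, and the last label below pays for the final level. *)
Lemma levels_above_ge m z (W : ksub n k) b : represents z W ->
  below z Y b != set0 -> (m <= #|below z Y b| + #|above z Y b|)%N ->
  (lev W + m <= l)%N.
Proof.
elim: m z W b => [|m IHm] z W b zW; first by rewrite addn0.
move=> /set0Pn[a0]; rewrite inE => lt_a0 le_m.
have [lt1|le1] := ltnP 1 #|below z Y b|.
  have [a a_min] := excess_bot kn z Y.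
  have lt_ab : excess Y z a + n%:Z < excess Y z b by have := a_min a0; lia.
  have [z' [W' [zW' lt_W e']]] := raise_min_lev zW a_min lt_ab.
  have e'b : excess Y z' b = excess Y z b.
    rewrite e' (_ : b == a = false) ?mulr0 ?addr0 //.
    by apply/eqP => eab; rewrite eab in lt_ab; lia.
  have sub_below : below z Y b :\ a \subset below z' Y b.
    apply/subsetP => c; rewrite !inE e'b e' => /andP[/negbTE->].
    by rewrite mulr0 addr0.
  have sub_above : above z Y b \subset above z' Y b.
    apply/subsetP => c; rewrite !inE e'b e'; case: (_ == _) => lt_c; lia.
  have a_below : a \in below z Y b by rewrite inE.
  have le_below : (#|below z Y b| <= #|below z' Y b|.+1)%N.
    by rewrite (cardsD1 a) a_below add1n ltnS; apply: subset_leq_card.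
  have le_above : (#|above z Y b| <= #|above z' Y b|)%N by apply: subset_leq_card.
  have : (lev W' + m <= l)%N.
    by apply: (IHm z' W' b zW'); [rewrite -card_gt0|]; lia.
  by lia.
have above_gt0 : (0 < #|above z Y b| \/ m = 0)%N by lia.
have {above_gt0} [|m0] := above_gt0; last first.
  have [a a_min] := excess_bot kn z Y.
  have lt_ab : excess Y z a + n%:Z < excess Y z b by have := a_min a0; lia.
  have [z' [W' [_ lt_W _]]] := raise_min_lev zW a_min lt_ab.
  by have := lev_le W'; rewrite m0; lia.
rewrite card_gt0 => /set0Pn[c0]; rewrite inE => lt_c0.
have [a a_max] := excess_top kn z Y.
have lt_ba : excess Y z b < excess Y z a by have := a_max c0; lia.
have lt_a : excess Y z a0 + n%:Z < excess Y z a by lia.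
have [z' [W' [zW' lt_W e']]] := lower_max_lev zW a_max lt_a.
have e'b : excess Y z' b = excess Y z b.
  by rewrite e' (_ : b == a = false) ?mulr0 ?subr0 //; apply/eqP => eab; rewrite eab ltxx in lt_ba.
have sub_below : below z Y b \subset below z' Y b.
  by apply/subsetP => c; rewrite !inE e'b e'; case: (_ == _) => lt_c; lia.
have sub_above : above z Y b :\ a \subset above z' Y b.
  apply/subsetP => c; rewrite !inE e'b e' => /andP[/negbTE->].
  by rewrite mulr0 subr0.
have a_above : a \in above z Y b by rewrite inE.
have le_below : (#|below z Y b| <= #|below z' Y b|)%N by apply: subset_leq_card.
have le_above : (#|above z Y b| <= #|above z' Y b|.+1)%N.
  by rewrite (cardsD1 a) a_above add1n ltnS; apply: subset_leq_card.
have : (lev W' + m <= l)%N.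
  apply: (IHm z' W' b zW'); last by lia.
  by apply/set0Pn; exists a0; apply: (subsetP sub_below); rewrite inE.
by lia.
Qed.

Lemma excess_eq z a b j : excess Y z a = excess Y z b + n%:Z * j -> a = b.
Proof. by move/(excess_inj kn Yalc). Qed.

(** If only [p] lies more than [n] below [q], one of the labels whose excesses are congruent to that
    of [p] plus 1 or plus 2 lies strictly between, more than [n] above [p] and below [q]. *)
Lemma levels_above_ge2 z (W : ksub n k) p q : (2 < n)%N -> represents z W ->
  excess Y z p + n%:Z + 2 <= excess Y z q -> (lev W + 2 <= l)%N.
Proof.
move=> n_gt2 zW.
wlog [p_min q_max] : p q / (forall c, excess Y z p <= excess Y z c) /\
    (forall c, excess Y z c <= excess Y z q) => [Hwlog le_pq|le_pq].
  have [p' p'_min] := excess_bot kn z Y; have [q' q'_max] := excess_top kn z Y.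
  apply: (Hwlog p' q') => //.
  by have := p'_min p; have := q'_max q; lia.
have split_at b c d : excess Y z c + n%:Z < excess Y z b ->
    excess Y z b < excess Y z d -> (lev W + 2 <= l)%N.
  move=> lt_c lt_d; have cb : c \in below z Y b by rewrite inE.
  have db : d \in above z Y b by rewrite inE.
  apply: (levels_above_ge zW (b := b)); first by apply/set0Pn; exists c.
  by rewrite (cardsD1 c (below _ _ _)) cb (cardsD1 d (above _ _ _)) db; lia.
have [[c cp lt_c]|no_c] := pselect (exists2 c, c <> p & excess Y z c + n%:Z < excess Y z q).
  apply: (levels_above_ge zW (b := q)); first by apply/set0Pn; exists c; rewrite inE.
  have pq : p \in below z Y q by rewrite inE; lia.
  have cq : c \in below z Y q :\ p by rewrite !inE lt_c andbT; apply/eqP.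
  by rewrite (cardsD1 p (below _ _ _)) pq (cardsD1 c (_ :\ _)) cq; lia.
have c_ge c : c <> p -> excess Y z q <= excess Y z c + n%:Z.
  by move=> cp; rewrite leNgt; apply/negP => lt_c; apply: no_c; exists c.
have c_ltq c : c <> q -> excess Y z c < excess Y z q.
  move=> cq; rewrite lt_neqAle q_max andbT; apply/eqP => ecq; apply: cq.
  by apply: (@excess_eq z c q 0); lia.
have [c [j ec]] := excess_surj kn Yalc z (excess Y z p + 1).
have cp : c <> p.
  move=> ecp; have := @mulz_small n j; rewrite ecp in ec; lia.
have [ecq|cq] := pselect (c = q); last first.
  apply: (split_at c p q); last exact: c_ltq.
  have j_gt0 : 1 <= j.
    by have := c_ge c cp; rewrite ec => le1; apply: (@mulz_lt_addr n); lia.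
  have : n%:Z * 1 <= n%:Z * j by rewrite ler_wpM2l.
  have : j <> 1 \/ j = 1 by lia.
  by rewrite ec; lia.
have [d [i ed]] := excess_surj kn Yalc z (excess Y z p + 2).
have dp : d <> p.
  move=> edp; have := @mulz_small n i; rewrite edp in ed; lia.
have dq : d <> q.
  move=> edq; have := @mulz_small n (j - i); rewrite -ecq in edq.
  by rewrite edq in ed; lia.
apply: (split_at d p q); last exact: c_ltq.
have j_gt1 : 2 <= j.
  by move: le_pq; rewrite -ecq ec => le1; apply: (@mulz_lt_addr n); lia.
have lej : n%:Z * 2 <= n%:Z * j by rewrite ler_wpM2l.
have i_gt0 : 1 <= i.
  by have := c_ge d dp; rewrite -ecq ec ed => le1; apply: (@mulz_lt_addr n); lia.
have : n%:Z * 1 <= n%:Z * i by rewrite ler_wpM2l.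
by rewrite ed; lia.
Qed.

(** Raising [p] gains one level and usually leaves a gap of [n + 2], worth two more. The exception
    is a gap of exactly [2 * n + 1]; then [q] is lowered instead, and the label congruent to [p]
    plus 2 provides the gap. *)
Lemma levels_above_ge3 z (W : ksub n k) p q : (2 < n)%N -> represents z W ->
  excess Y z p + 2 * n%:Z <= excess Y z q -> (lev W + 3 <= l)%N.
Proof.
move=> n_gt2 zW.
wlog [p_min q_max] : p q / (forall c, excess Y z p <= excess Y z c) /\
    (forall c, excess Y z c <= excess Y z q) => [Hwlog le_pq|le_pq].
  have [p' p'_min] := excess_bot kn z Y; have [q' q'_max] := excess_top kn z Y.
  apply: (Hwlog p' q') => //.
  by have := p'_min p; have := q'_max q; lia.
have ne_pq : excess Y z q <> excess Y z p + n%:Z * 2.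
  by move=> epq; have eqp := excess_eq epq; rewrite eqp in le_pq; lia.
have lt_pq : excess Y z p + n%:Z < excess Y z q by lia.
have [z' [W' [zW' lt_W e']]] := raise_min_lev zW p_min lt_pq.
have e'q : excess Y z' q = excess Y z q.
  by rewrite e' (_ : q == p = false) ?mulr0 ?addr0 //; apply/eqP => eqp; rewrite eqp in lt_pq; lia.
have [[c le_c]|no_c] := pselect (exists c, excess Y z' c + n%:Z + 2 <= excess Y z q).
  rewrite -e'q in le_c; have := levels_above_ge2 n_gt2 zW' le_c; lia.
have c_ge c : excess Y z q <= excess Y z' c + n%:Z + 1.
  by rewrite leNgt; apply/negP => lt_c; apply: no_c; exists c; lia.
have eq_q : excess Y z q = excess Y z p + 2 * n%:Z + 1.
  by have := c_ge p; rewrite e' eqxx; lia.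
have [z2 [W2 [zW2 lt_W2 e2]]] := lower_max_lev zW q_max lt_pq.
have [d [i ed]] := excess_surj kn Yalc z (excess Y z p + 2).
have dp : d <> p.
  by move=> edp; have := @mulz_small n i; rewrite edp in ed; lia.
have dq : d <> q.
  by move=> edq; have := @mulz_small n (2 - i); rewrite edq in ed; lia.
have i_gt0 : 1 <= i.
  have := c_ge d; rewrite e' (_ : d == p = false) ?mulr0 ?addr0; last exact/eqP.
  by rewrite ed => le1; apply: (@mulz_lt_addr n); lia.
have lei : n%:Z * 1 <= n%:Z * i by rewrite ler_wpM2l.
have le2 : excess Y z2 p + n%:Z + 2 <= excess Y z2 d.
  rewrite !e2 (_ : d == q = false) ?mulr0 ?subr0; last exact/eqP.
  by rewrite (_ : p == q = false) ?mulr0 ?subr0; [lia|apply/eqP => epq; rewrite epq in lt_pq; lia].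
by have := levels_above_ge2 n_gt2 zW2 le2; lia.
Qed.

End LevelCount.

(** * Comparison of the cube distance with the number of levels *)

Lemma ksub_full n k (I I' : ksub n k) : (n <= k)%N -> I = I'.
Proof.
move=> nk; suff full (K : ksub n k) : val K = setT by apply: val_inj; rewrite !full.
apply/eqP; rewrite eqEcard subsetT cardsT card_ord /=.
by have /eqP-> := valP K.
Qed.

Lemma cube_d_le n k D (C1 C2 : {set ksub n k}) : cube_path D C1 C2 ->
  exists2 d, cube_d C1 C2 d & (d <= D)%N.
Proof.
move=> path; have exP : exists d, `[< cube_path d C1 C2 >] by exists D; apply/asboolP.
case: (ex_minnP exP) => d /asboolP pathd d_min; exists d; last exact/d_min/asboolP.
by split=> // d' pathd'; apply/d_min/asboolP.
Qed.

Local Close Scope ring_scope.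

Theorem theorem5p4 (R : realType) (n k : nat) (hk : 1 <= k) (hkn : k <= n)
    (J : {set ksub n k})
    (hJ : maximal_arrangement_of_largest_minors R J)
    (W : ksub n k) (hW : W \notin J)
    (t : nat) (ht : cube_d_minor J W t)
    (hcase : (t = 2 \/ t = 3) \/ k = 2) :
  ge_largest_minor R (t + 1) J W.
Proof.
move=> l U [osp [A [[_ A_gt0] A_eq A_lt]]] U_max i le_i; apply/negP => WUi.
have [lev levU] : exists lev : ksub n k -> 'I_l.+1, forall V, V \in U (lev V).
  apply: (@fin_all_exists _ _ (fun V j => V \in U j)) => V.
  have : V \in \bigcup_i U i by rewrite (osp_cover osp) inE.
  by case/bigcupP => j _ VUj; exists j.
have lev_lt V V' : (Delta A V < Delta A V')%R -> lev V < lev V'.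
  move=> lt_V; rewrite ltnNge leq_eqVlt; apply/negP => /orP[/eqP/ord_inj eq_lev|lt_lev].
    by move: lt_V; rewrite (A_eq (lev V) V V') ?ltxx // -eq_lev.
  by have := A_lt _ _ _ _ lt_lev (levU V') (levU V); rewrite ltNge (ltW lt_V).
have lev_le V : lev V <= l by rewrite -ltnS.
have levW : lev W = i.
  apply/eqP; apply: contraTT WUi => neq; apply/negP => WUi.
  by have /pred0P/(_ W) := osp_disjoint osp neq; rewrite /= levU WUi.
have [V0 V0J] : exists V0, V0 \in J.
  apply/set0Pn; apply: contraTneq (levU W) => J0.
  have : ord_max == ord0 :> 'I_l.+1.
    by apply: contraTT (eqxx J) => /(osp_nonempty osp); rewrite U_max J0 eqxx.
  move=> /eqP e0; have l0 : l = 0 by have := congr1 (@nat_of_ord _) e0.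
  rewrite (_ : lev W = ord0) ?(osp_zero osp) ?inE //.
  by apply: ord_inj => /=; have := lev_le W; lia.
have A_J V : V \in J -> Delta A V = Delta A V0.
  by move=> VJ; apply: (A_eq ord_max); rewrite U_max.
have A_le V : (Delta A V <= Delta A V0)%R.
  rewrite leNgt; apply/negP => lt_V0.
  have := lev_lt _ _ lt_V0; have := lev_le V.
  suff -> : lev V0 = ord_max by move=> /=; lia.
  apply/eqP; apply: contraTT V0J => neq; apply/negP => V0J.
  by have /pred0P/(_ V0) := osp_disjoint osp neq; rewrite /= levU U_max V0J.
have lt_kn : 0 < k < n.
  rewrite hk ltnNge; apply: contra hW => nk; by rewrite (ksub_full W V0 nk).
(* The cube path behind [t] starts at [J], which is therefore a maximal sorted collection, hence an
   alcove. *)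
have [[C2 [_ _ [[c [c0 _ c_max _]] _]]] t_min] := ht.
have J_max : max_sorted J by rewrite -c0; apply: c_max.
have /maxsetP[J_sorted J_maxl] := J_max.
have J_neq0 : J != set0 by apply/set0Pn; exists V0.
have [Y Yalc JY] := sorted_sub_simplex lt_kn J_neq0 J_sorted.
have eJ : simplex k Y = J := J_maxl _ (sorted_simplex lt_kn Yalc) JY.
have A_simplex V : V \in simplex k Y -> Delta A V = Delta A V0.
  by rewrite eJ; apply: A_J.
have zW := height_represents W.
(* By [le_i] at most [t - 1] levels lie above [W]. For [t] at most 3 this is fewer than the three
   levels that a gap of [2 * n] would force. *)
have diam a b : (excess Y (height W) a - excess Y (height W) b < 2 * n%:Z)%R.
  have lt_nk := excess_height_lt W b a lt_kn Yalc.
  case: hcase => [t23|k2]; last first.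
    by apply: (lt_le_trans lt_nk); rewrite k2 PoszM mulrC.
  rewrite ltNge; apply/negP => ge.
  have n_gt2 : 2 < n.
    have : n * 2 < n * k by rewrite -ltz_nat (le_lt_trans _ lt_nk) // PoszM mulrC.
    by rewrite ltn_pmul2l; lia.
  have le_ab : (excess Y (height W) b + 2 * n%:Z <= excess Y (height W) a)%R by lia.
  have := levels_above_ge3 lt_kn Yalc A_gt0 A_le A_simplex lev_lt lev_le n_gt2 zW le_ab.
  by rewrite levW; lia.
have bound b : below (height W) Y b != set0 ->
    #|below (height W) Y b| + #|above (height W) Y b| <= l - i.
  move=> b_below; rewrite -levW leq_subRL //.
  exact: (levels_above_ge lt_kn Yalc A_gt0 A_le A_simplex lev_lt lev_le zW b_below).
have [C [D [le_D C_max WC]]] := exists_cube_path lt_kn Yalc zW diam bound.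
rewrite eJ => /cube_d_le[d JCd le_dD].
(* The path uses at most [l - i] cubes, hence fewer than [t], against the minimality of [t]. *)
have := t_min d (ex_intro _ C (And3 C_max WC JCd)).
by have := lev_le W; rewrite levW; lia.
Qed.
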